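(* Let $(\mathfrak{H},\mathcal{J},\mathcal{M},\{\mathcal{S}_\varepsilon\}_{\varepsilon>0})$ satisfy the differential-structure, scaling-structure and multiscale-material-coefficient hypotheses stated in the context, let $\alpha,\delta,\varepsilon>0$, and let $\bar{\mathcal{V}}$, $\Pi_0$ be as defined there. Let $E_\lambda$ be the spectral measure of $-i\mathcal{J}_{\mathrm{micro}}$. Then $$\|(\mathcal{J}_{\mathrm{micro}}+\delta\varepsilon I)^{-1}\bar{\mathcal{V}}\Pi_0\|_{\mathfrak{V}\to\mathfrak{H}}^2=\sup_{\|u\|_{\mathfrak{V}}=1}\int_{\mathbb{R}}\frac{1}{\lambda^2+(\delta\varepsilon)^2}\,d\|E_\lambda\bar{\mathcal{V}}\Pi_0u\|^2=:\mathbb{I}.$$ Moreover, for a fixed $\lambda_0>0$, $$\mathbb{I}=\sup_{\|u\|_{\mathfrak{V}}=1}\int_{|\lambda|<\lambda_0}\frac{1}{\lambda^2+(\delta\varepsilon)^2}\,d\|E_\lambda\bar{\mathcal{V}}\Pi_0u\|^2+\mathcal{O}(1).$$ Suppose further that $\mathcal{J}$ commutes strongly with $\mathcal{J}_{\mathrm{micro}}$. Then $$\begin{aligned}\|(\mathcal{J}_{\mathrm{micro}}+\delta\varepsilon I)^{-1}\bar{\mathcal{V}}\Pi_0\|_{\mathfrak{H}\to\mathfrak{V}^*}^2&=\sup_{\|f\|=1}\int_{\mathbb{R}}\frac{1}{\lambda^2+(\delta\varepsilon)^2}\,d\|E_\lambda\bar{\mathcal{V}}\Pi_0f\|_{\mathfrak{V}^*}^2\\&=\sup_{\|f\|=1}\int_{|\lambda|<\lambda_0}\frac{1}{\lambda^2+(\delta\varepsilon)^2}\,d\|E_\lambda\bar{\mathcal{V}}\Pi_0f\|_{\mathfrak{V}^*}^2+\mathcal{O}(1).\end{aligned}$$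 Here $\mathcal{O}(1)$ denotes a quantity bounded as $\varepsilon\to0$.
   Context: Differential structure: $\mathfrak{H}$ is a Hilbert space and $\mathcal{J}:\operatorname{dom}\mathcal{J}\subset\mathfrak{H}\to\mathfrak{H}$ is closed, densely defined and skew-adjoint ($\mathcal{J}^*=-\mathcal{J}$). $\mathfrak{V}=\operatorname{dom}(\mathcal{J})$ carries the graph norm $\|u\|_{\mathfrak{V}}^2=\|u\|^2+\|\mathcal{J}u\|^2$; $\mathfrak{V}\hookrightarrow\mathfrak{H}\hookrightarrow\mathfrak{V}^*$ is the associated Gelfand triple ($\mathfrak{H}$ identified with its dual), and $\mathcal{J}$ is extended to a bounded operator $\mathfrak{H}\to\mathfrak{V}^*$ by $\langle\mathcal{J}u,v\rangle_{\mathfrak{V}^*,\mathfrak{V}}=-\langle u,\mathcal{J}v\rangle$. Scaling structure: $\{\mathcal{S}_\varepsilon\}_{\varepsilon>0}$ is a family of unitary operators on $\mathfrak{H}$ such that there exist closed, densely defined, skew-adjoint operators $\mathcal{J}_{\mathrm{macro}}$, $\mathcal{J}_{\mathrm{micro}}$ on $\mathfrak{H}$ with $[\mathcal{J}_{\mathrm{macro}},\mathcal{J}_{\mathrm{micro}}]=0$ and $\mathcal{S}_\varepsilon^{-1}\mathcal{J}\mathcal{S}_\varepsilon=\mathcal{J}_{\mathrm{macro}}+\frac1\varepsilon\mathcal{J}_{\mathrm{micro}}$; moreover $\mathcal{S}_\varepsilon$ acts as the identity on $\ker(\mathcal{J}_{\mathrm{micro}})$. Projections (a projection and its range are denoted by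 the same symbol): $\mathcal{P}_0$ is the orthogonal projection onto $\ker(\mathcal{J}_{\mathrm{micro}})$; $\Pi_0$ is the orthogonal projection onto the (closure of the) subspace $\{u\in\mathcal{P}_0:\mathcal{J}_{\mathrm{macro}}u\in\mathcal{P}_0\}$; $\Pi_{\mathrm{fluct}}=\mathcal{P}_0-\Pi_0$. Multiscale material coefficients: $\mathcal{M}$ is an operator on $\mathfrak{H}$ and there are $M_\square>0$, $m_\square\ge0$ with $\|\mathcal{M}\|_{\mathfrak{H}\to\mathfrak{H}}\le M_\square$ and $\operatorname{Re}\langle\mathcal{M}u,u\rangle\ge m_\square\|u\|^2$ for all $u\in\mathfrak{H}$. One defines $$\mathcal{M}_0=\Pi_0\mathcal{M}\Pi_0-\Pi_0\mathcal{M}\Pi_{\mathrm{fluct}}(\Pi_{\mathrm{fluct}}\mathcal{M}\Pi_{\mathrm{fluct}}+\alpha I)^{-1}\Pi_{\mathrm{fluct}}\mathcal{M}\Pi_0,\qquad \mathcal{M}_\varepsilon=\mathcal{S}_\varepsilon\mathcal{M}\mathcal{S}_\varepsilon^{-1},$$ $$\mathcal{K}_{\mathrm{micro}}=-\Pi_{\mathrm{fluct}}(\Pi_{\mathrm{fluct}}\mathcal{M}\Pi_{\mathrm{fluct}}+\alpha I)^{-1}\Pi_{\mathrm{fluct}}\mathcal{M}\Pi_0,$$ $$\bar{\mathcal{V}}=\mathcal{M}_0-\mathcal{M}(I+\mathcal{K}_{\mathrm{micro}})-\mathcal{J}_{\mathrm{macro}}\mathcal{K}_{\mathrm{micro}}-\alpha\mathcal{K}_{\mathrm{micro}}.$$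 The operator $\bar{\mathcal{V}}\Pi_0$ is regarded as a bounded operator $\mathfrak{V}\to\mathfrak{H}$ and $\mathfrak{H}\to\mathfrak{V}^*$. In the second part, $E_\lambda$ and $(\mathcal{J}_{\mathrm{micro}}+\delta\varepsilon I)^{-1}$ acting on $\mathfrak{V}^*$ denote the unique bounded extensions of these operators from $\mathfrak{H}$ to $\mathfrak{V}^*$. Strong commutation of two skew-adjoint operators means that their spectral measures commute. *)

(* Defs.v *)
From HB Require Import structures.
From mathcomp Require Import all_boot all_order all_algebra.
From mathcomp Require Import all_classical all_reals all_analysis.
From mathcomp Require Import complex.

Set Implicit Arguments.
Unset Strict Implicit.
Unset Printing Implicit Defensive.

Import Order.TTheory GRing.Theory Num.Theory.
Import numFieldNormedType.Exports.

Local Open Scope classical_set_scope.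
Local Open Scope complex_scope.
Local Open Scope ring_scope.

(* The inner product is linear in its first argument and conjugate-linear in
   the second one. *)
Definition dot_norm (R : realType) (H : lmodType R[i])
    (dot : {dot H for Num.conj}) (u : H) : R := Num.sqrt (complex.Re (dot u u)).

Record hilbertType (R : realType) := HilbertType {
  hilbert_sort :> lmodType R[i];
  hdot : {dot hilbert_sort for Num.conj};
  hilbert_complete : forall x : nat -> hilbert_sort,
    (forall e : R, 0 < e -> exists N : nat, forall m n : nat,
       (N <= m)%N -> (N <= n)%N -> dot_norm hdot (x m - x n) < e) ->
    exists l : hilbert_sort,
      (fun n => dot_norm hdot (x n - l)) @ \oo --> (0 : R)
}.

Section Operators.
Context {R : realType} {H : hilbertType R}.
Implicit Types (u v w f h : H) (c : R[i]).

Definition hnorm u : R := dot_norm (hdot H) u.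

Definition hclosure (A : set H) : set H :=
  [set u | forall e : R, 0 < e -> exists2 a, A a & hnorm (u - a) < e].

(* An unbounded operator is a total function together with a domain; values
   off the domain are irrelevant. *)
Record operator := Operator { dom : set H; app :> H -> H }.
Implicit Type A : operator.

Definition linear_operator A : Prop :=
  dom A 0 /\
  forall c u v, dom A u -> dom A v ->
    dom A (c *: u + v) /\ A (c *: u + v) = c *: A u + A v.

Definition graph A : set (H * H) := [set p | dom A p.1 /\ p.2 = A p.1].

Definition graph_closure (G : set (H * H)) : set (H * H) :=
  [set p | forall e : R, 0 < e ->
     exists q, [/\ G q, hnorm (p.1 - q.1) < e & hnorm (p.2 - q.2) < e]].

Definition adjoint_graph A : set (H * H) :=
  [set p | forall u, dom A u -> hdot H (A u) p.1 = hdot H u p.2].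

Definition scale_op c A : operator := Operator (dom A) (fun u => c *: A u).
Definition add_op A (A' : operator) : operator :=
  Operator (dom A `&` dom A') (fun u => A u + A' u).
Definition shift_op A c : operator := Operator (dom A) (fun u => A u + c *: u).

Definition ker_op A : set H := [set u | dom A u /\ A u = 0].

Definition inv_op A (y : H) : H := xget 0 [set x | dom A x /\ A x = y].
Definition inv_fun (T : H -> H) : H -> H := inv_op (Operator setT T).

Record closed_skew_adjoint A : Prop := {
  csa_linear : linear_operator A;
  csa_dense : hclosure (dom A) = setT;
  csa_closed : graph_closure (graph A) = graph A;
  csa_skew : adjoint_graph A = graph (scale_op (-1) A)
}.

Definition unitary (U : {linear H -> H}) : Prop :=
  bijective U /\ forall u v, hdot H (U u) (U v) = hdot H u v.

Definition conj_op (U : {linear H -> H}) A : operator :=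
  Operator [set u | dom A (U u)] (fun u => inv_fun U (A (U u))).

(* The two products agree wherever both are defined. *)
Definition commutator_zero A (A' : operator) : Prop :=
  forall u, dom A u -> dom A' u -> dom A (A' u) -> dom A' (A u) ->
    A (A' u) = A' (A u).

Definition orth_proj (K : set H) (u : H) : H :=
  xget 0 [set p | K p /\ forall a, K a -> hdot H (u - p) a = 0].

Record projection_valued_measure (E : set R -> H -> H) : Prop := {
  pvm_linear : forall B, measurable B -> forall c u v,
    E B (c *: u + v) = c *: E B u + E B v;
  pvm_self_adjoint : forall B, measurable B -> forall u v,
    hdot H (E B u) v = hdot H u (E B v);
  pvm_setT : forall u, E setT u = u;
  pvm_set0 : forall u, E set0 u = 0;
  pvm_setI : forall B C, measurable B -> measurable C -> forall u,
    E (B `&` C) u = E B (E C u);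
  pvm_sigma_additive : forall B : nat -> set R,
    (forall n, measurable (B n)) -> trivIset setT B -> forall u,
    (fun n => hnorm (E (\bigcup_k B k) u - \sum_(0 <= k < n) E (B k) u))
      @ \oo --> (0 : R)
}.

Definition spectral_mass (E : set R -> H -> H) u : set R -> \bar R :=
  fun B => ((hnorm (E B u)) ^+ 2)%:E.

(* A = \int l dE_l, in quadratic form sense (which determines A by
   polarization, the scalars being complex). *)
Definition spectral_measure_of A (E : set R -> H -> H) : Prop :=
  [/\ projection_valued_measure E,
      dom A = [set u | (\int[spectral_mass E u]_l ((l ^+ 2)%:E) < +oo)%E] &
      forall u, dom A u ->
        hdot H (A u) u = (fine (\int[spectral_mass E u]_l (l%:E))%E)%:C].

Definition pvm_commute (E F : set R -> H -> H) : Prop :=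
  forall B C, measurable B -> measurable C -> forall u,
    E B (F C u) = F C (E B u).

(* Supremum of a set of nonnegative quantities; it is 0 for the empty set,
   so that the trivial Hilbert space needs no separate treatment. *)
Definition nonneg_sup (A : set (\bar R)) : \bar R := maxe 0%E (ereal_sup A).

End Operators.

Arguments operator {R} H.

Section GelfandTriple.
Context {R : realType} {H : hilbertType R} (J : operator H).
Implicit Types (u v f h : H) (phi psi : H -> R[i]).

Definition graph_norm u : R := Num.sqrt (hnorm u ^+ 2 + hnorm (J u) ^+ 2).

(* V^* consists of the bounded conjugate-linear functionals on V = dom J.  They
   are represented by functions on H of which only the values on V matter. *)
Definition dual_norm phi : \bar R :=
  ereal_sup [set (complex.Re `|phi v|)%:E
            | v in [set v | dom J v /\ graph_norm v <= 1]].

Definition dual_space : set (H -> R[i]) :=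
  [set phi | (forall (c : R[i]) u v, dom J u -> dom J v ->
                phi (c *: u + v) = c^* * phi u + phi v) /\
             (dual_norm phi < +oo)%E].

Definition dual_eq phi psi : Prop := forall v, dom J v -> phi v = psi v.

Definition embed h : H -> R[i] := fun v => hdot H h v.

Definition opnorm_VH (T : H -> H) : \bar R :=
  ereal_sup [set (hnorm (T u))%:E
            | u in [set u | dom J u /\ graph_norm u <= 1]].

Definition opnorm_HVdual (W : H -> H -> R[i]) : \bar R :=
  ereal_sup [set dual_norm (W f) | f in [set f | hnorm f <= 1]].

(* W : H -> V^* is the bounded extension of T : V -> H. *)
Definition bounded_extension_HVdual (T : H -> H) (W : H -> H -> R[i]) : Prop :=
  [/\ forall f, dual_space (W f),
      forall (c : R[i]) f h,
        dual_eq (W (c *: f + h)) (fun v => c * W f v + W h v),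
      (opnorm_HVdual W < +oo)%E &
      forall u, dom J u -> dual_eq (W u) (embed (T u))].

Definition is_dual_extension (T : H -> H)
    (T' : (H -> R[i]) -> (H -> R[i])) : Prop :=
  [/\ forall phi, dual_space phi -> dual_space (T' phi),
      forall (c : R[i]) phi psi, dual_space phi -> dual_space psi ->
        dual_eq (T' (fun v => c * phi v + psi v))
                (fun v => c * T' phi v + T' psi v),
      exists C : R, forall phi, dual_space phi ->
        (dual_norm (T' phi) <= C%:E * dual_norm phi)%E &
      forall h, dual_eq (T' (embed h)) (embed (T h))].

(* The unique bounded extension of T from H to V^*. *)
Definition dual_extension (T : H -> H) : (H -> R[i]) -> (H -> R[i]) :=
  xget (id : (H -> R[i]) -> (H -> R[i])) [set T' | is_dual_extension T T'].

Definition dual_spectral_mass (E : set R -> H -> H) phi : set R -> \bar R :=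
  fun B => ((dual_norm (dual_extension (E B) phi)) ^+ 2)%E.

End GelfandTriple.

Section Multiscale.
Context {R : realType} {H : hilbertType R}.
Implicit Types (J Jmacro Jmicro : operator H) (u : H).

(* The sum is understood as the closure of the operator sum, whose natural
   domain is dom Jmacro `&` dom Jmicro. *)
Record scaling_structure J (S : R -> {linear H -> H}) Jmacro Jmicro : Prop := {
  scaling_unitary : forall eps, 0 < eps -> unitary (S eps);
  scaling_macro : closed_skew_adjoint Jmacro;
  scaling_micro : closed_skew_adjoint Jmicro;
  scaling_commute : commutator_zero Jmacro Jmicro;
  scaling_sum : forall eps, 0 < eps ->
    graph (conj_op (S eps) J) =
    graph_closure (graph (add_op Jmacro (scale_op (eps^-1)%:C Jmicro)));
  scaling_ker : forall eps, 0 < eps -> forall u, ker_op Jmicro u -> S eps u = u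
}.

Definition material_coefficients (M : {linear H -> H}) (Mbox mbox : R) : Prop :=
  [/\ 0 < Mbox, 0 <= mbox,
      forall u, hnorm (M u) <= Mbox * hnorm u &
      forall u, mbox * hnorm u ^+ 2 <= complex.Re (hdot H (M u) u)].

Context (Jmacro Jmicro : operator H) (M : {linear H -> H}) (alpha : R).

Definition P0 : H -> H := orth_proj (ker_op Jmicro).

Definition Pi0 : H -> H :=
  orth_proj (hclosure [set u | [/\ range P0 u, dom Jmacro u &
                                   range P0 (Jmacro u)]]).

Definition Pifluct u : H := P0 u - Pi0 u.

Definition fluct_inv : H -> H :=
  inv_fun (fun u => Pifluct (M (Pifluct u)) + alpha%:C *: u).

Definition M0 u : H :=
  Pi0 (M (Pi0 u)) -
  Pi0 (M (Pifluct (fluct_inv (Pifluct (M (Pi0 u)))))).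

Definition Kmicro u : H := - Pifluct (fluct_inv (Pifluct (M (Pi0 u)))).

Definition Vbar : operator H :=
  Operator [set u | dom Jmacro (Kmicro u)]
    (fun u => M0 u - M (u + Kmicro u) - Jmacro (Kmicro u)
              - alpha%:C *: Kmicro u).

Definition VbarPi0 u : H := Vbar (Pi0 u).

Definition VbarPi0_bounded_VH J : Prop :=
  (forall u, dom J u -> dom Vbar (Pi0 u)) /\ (opnorm_VH J VbarPi0 < +oo)%E.

Definition resolvent (c : R) : H -> H := inv_op (shift_op Jmicro c%:C).

Definition weighted_integral (mu : set R -> \bar R) (c : R) (D : set R) :
    \bar R :=
  (\int[mu]_(l in D) ((l ^+ 2 + c ^+ 2)^-1)%:E)%E.

Definition sup_VH J (E : set R -> H -> H) (c : R) (D : set R) : \bar R :=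
  nonneg_sup [set weighted_integral (spectral_mass E (VbarPi0 u)) c D
             | u in [set u | dom J u /\ graph_norm J u = 1]].

Definition sup_HVdual J (E : set R -> H -> H) (W : H -> H -> R[i]) (c : R)
    (D : set R) : \bar R :=
  nonneg_sup [set weighted_integral (dual_spectral_mass J E (W f)) c D
             | f in [set f | hnorm f = 1]].

End Multiscale.

(* Main.v *)
(* Write A for the self-adjoint operator -i K of a skew-adjoint K, and mu_x for
   the measure B |-> |E_B x|^2.  The spectral measure is only given through the
   quadratic form <A x, x> = \int l dmu_x, so three facts are first derived from
   it by polarization, always comparing nonnegative measures: bounded operators
   commuting with E commute with A; |A x|^2 = \int l^2 dmu_x; and hence, for
   y = (K + c) x, the measure mu_y has density l^2 + c^2 with respect to mu_x.
   Integrating (l^2 + c^2)^-1 gives |(K + c)^-1 y|^2 = \int (l^2 + c^2)^-1 dmu_y,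
   and the homogeneity of Vbar Pi0 turns suprema over the unit ball into suprema
   over the unit sphere.  Away from |l| < lambda0 the weight is at most
   lambda0^-2, uniformly in epsilon, which gives the O(1) statements.  For the
   dual norm, v |-> v - J v is an isometry of dom J with the graph norm onto the
   Hilbert space; it represents a functional phi by a vector g of the same norm,
   and the extension to the dual of an operator T commuting with J maps phi to
   the functional represented by T g.  So the dual statement reduces to the
   Hilbert space one for g. *)
Require Import Defs.
From HB Require Import structures.
From mathcomp Require Import all_boot all_order all_algebra.
From mathcomp Require Import all_classical all_reals all_analysis.
From mathcomp Require Import complex.
From mathcomp Require Import measurable_realfun.
From mathcomp Require Import ring lra.
Import Order.TTheory GRing.Theory Num.Theory.
Import numFieldNormedType.Exports.
Set Implicit Arguments.
Unset Strict Implicit.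
Unset Printing Implicit Defensive.
Local Open Scope classical_set_scope.
Local Open Scope complex_scope.
Local Open Scope ring_scope.

(** * Complex inner products *)

Section InnerProduct.
Context {R : realType} {H : hilbertType R}.
Implicit Types (u v w : H) (t : R) (c : R[i]).

(** Taking the real part turns norm estimates and polarization into identities over [R], within
    reach of [ring], [lra] and [nra]; [hdotE] recovers the complex product. *)
Definition rdot u v : R := complex.Re (hdot H u v).

Lemma hdotC u v : hdot H u v = (hdot H v u)^*.
Proof. by rewrite hermC expr0 mul1r. Qed.

Lemma hdotDl u v w : hdot H (u + v) w = hdot H u w + hdot H v w.
Proof. exact: linearDl. Qed.

Lemma hdotDr u v w : hdot H u (v + w) = hdot H u v + hdot H u w.
Proof. exact: linearDr. Qed.

Lemma hdotZl c u v : hdot H (c *: u) v = c * hdot H u v.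
Proof. exact: linearZl_LR. Qed.

Lemma hdotZr c u v : hdot H u (c *: v) = c^* * hdot H u v.
Proof. exact: linearZr_LR. Qed.

Lemma hdotNl u v : hdot H (- u) v = - hdot H u v.
Proof. exact: linearNl. Qed.

Lemma hdotNr u v : hdot H u (- v) = - hdot H u v.
Proof. exact: linearNr. Qed.

Lemma hdotBl u v w : hdot H (u - v) w = hdot H u w - hdot H v w.
Proof. by rewrite hdotDl hdotNl. Qed.

Lemma hdotBr u v w : hdot H u (v - w) = hdot H u v - hdot H u w.
Proof. by rewrite hdotDr hdotNr. Qed.

Lemma ReD (x y : R[i]) : complex.Re (x + y) = complex.Re x + complex.Re y.
Proof. by case: x y => [? ?] [? ?]. Qed.

Lemma ReN (x : R[i]) : complex.Re (- x) = - complex.Re x.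
Proof. by case: x => [? ?]. Qed.

Lemma ReZ t (x : R[i]) : complex.Re (t%:C * x) = t * complex.Re x.
Proof. by case: x => [a b] /=; rewrite mul0r subr0. Qed.

Lemma Re_conj (x : R[i]) : complex.Re (x^*) = complex.Re x.
Proof. by case: x. Qed.

Lemma real_complex_conj t : ((t%:C)^* : R[i]) = t%:C.
Proof. exact: conjc_real. Qed.

Lemma rdotC u v : rdot u v = rdot v u.
Proof. by rewrite /rdot hdotC Re_conj. Qed.

Lemma rdotDl u v w : rdot (u + v) w = rdot u w + rdot v w.
Proof. by rewrite /rdot hdotDl ReD. Qed.

Lemma rdotDr u v w : rdot u (v + w) = rdot u v + rdot u w.
Proof. by rewrite /rdot hdotDr ReD. Qed.

Lemma rdotNl u v : rdot (- u) v = - rdot u v.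
Proof. by rewrite /rdot hdotNl ReN. Qed.

Lemma rdotNr u v : rdot u (- v) = - rdot u v.
Proof. by rewrite /rdot hdotNr ReN. Qed.

Lemma rdotZl t u v : rdot (t%:C *: u) v = t * rdot u v.
Proof. by rewrite /rdot hdotZl ReZ. Qed.

Lemma rdotZr t u v : rdot u (t%:C *: v) = t * rdot u v.
Proof. by rewrite /rdot hdotZr real_complex_conj ReZ. Qed.

Lemma rdot0l u : rdot 0 u = 0.
Proof. by rewrite /rdot linear0l. Qed.

Lemma rdot0r u : rdot u 0 = 0.
Proof. by rewrite rdotC rdot0l. Qed.

Definition rdotE := (rdotDl, rdotDr, rdotNl, rdotNr, rdotZl, rdotZr).

Lemma rdotiN u v : rdot ('i%C *: u) v = - complex.Im (hdot H u v).
Proof. by rewrite /rdot hdotZl; case: (hdot H u v) => a b /=; rewrite mul0r mul1r sub0r. Qed.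

Lemma hdotE u v : hdot H u v = rdot u v +i* (- rdot ('i%C *: u) v).
Proof. by rewrite rdotiN opprK /rdot; case: (hdot H u v). Qed.

Lemma rdotii u v : rdot ('i%C *: u) ('i%C *: v) = rdot u v.
Proof.
rewrite /rdot hdotZl hdotZr mulrA.
have -> : 'i%C * ('i%C : R[i])^* = 1 by rewrite -normCK -add_Re2_Im2 /= expr0n expr1n add0r.
by rewrite mul1r.
Qed.

(** Multiplication by ['i] preserves [rdot], so [rdot ('i u) u] equals its own opposite and the
    imaginary part vanishes. *)
Lemma hdot_self u : hdot H u u = (rdot u u)%:C.
Proof.
rewrite hdotE; have : rdot ('i%C *: u) u = - rdot ('i%C *: u) u; last first.
  by move=> h; congr (_ +i* _); lra.
rewrite [LHS]rdotC -rdotii scalerA -expr2 sqr_i scaleN1r rdotNr.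
by [].
Qed.

Lemma rdot_ge0 u : 0 <= rdot u u.
Proof. by rewrite -lecR -hdot_self dnorm_ge0. Qed.

Lemma rdot_eq0 u : (rdot u u == 0) = (u == 0).
Proof. by rewrite -(dnorm_eq0 (hdot H)) hdot_self -(inj_eq (@complexI R)). Qed.

Lemma hnorm_sqr u : hnorm u ^+ 2 = rdot u u.
Proof. by rewrite /hnorm /dot_norm sqr_sqrtr // rdot_ge0. Qed.

Lemma hnorm_ge0 u : 0 <= hnorm u.
Proof. exact: sqrtr_ge0. Qed.
Hint Resolve hnorm_ge0 : core.

Lemma hnorm_eq0 u : (hnorm u == 0) = (u == 0).
Proof. by rewrite -sqrf_eq0 hnorm_sqr rdot_eq0. Qed.

Lemma hnorm0 : hnorm (0 : H) = 0.
Proof. by apply/eqP; rewrite hnorm_eq0. Qed.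

Lemma hnormZ c u : hnorm (c *: u) = complex.Re `|c| * hnorm u.
Proof.
have c0 : 0 <= complex.Re `|c| by rewrite normc_def /= sqrtr_ge0.
apply/eqP; rewrite -(@eqrXn2 _ 2) ?mulr_ge0 // exprMn !hnorm_sqr /rdot.
rewrite hdotZl hdotZr mulrA -normCK (hdot_self u) /=.
by rewrite !(mulr0, mul0r, subr0, addr0) expr2.
Qed.

Lemma Re_norm_real t : complex.Re `|t%:C| = `|t|.
Proof. by rewrite normc_def /= expr0n /= addr0 sqrtr_sqr. Qed.

Lemma hnormZr t u : hnorm (t%:C *: u) = `|t| * hnorm u.
Proof. by rewrite hnormZ Re_norm_real. Qed.

Lemma hnorm_opp u : hnorm (- u) = hnorm u.
Proof. by rewrite /hnorm /dot_norm hdotNl hdotNr opprK. Qed.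

Lemma hnormBC u v : hnorm (u - v) = hnorm (v - u).
Proof. by rewrite -hnorm_opp opprB. Qed.

Lemma rdot_CS u v : rdot u v <= hnorm u * hnorm v.
Proof.
have [->|u0] := eqVneq u 0; first by rewrite rdot0l hnorm0 mul0r.
have [->|v0] := eqVneq v 0; first by rewrite rdot0r hnorm0 mulr0.
have au : 0 < hnorm u by rewrite lt_def hnorm_eq0 u0 /=.
have av : 0 < hnorm v by rewrite lt_def hnorm_eq0 v0 /=.
(* The square expands to [2 |u| |v| (|u| |v| - rdot u v)], whose first factors are positive. *)
have := rdot_ge0 ((hnorm v)%:C *: u - (hnorm u)%:C *: v).
rewrite !rdotE (rdotC v u) -!hnorm_sqr => h.
have h2 : 0 <= 2 * (hnorm u * hnorm v) * (hnorm u * hnorm v - rdot u v) by nra.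
by rewrite -subr_ge0 -(pmulr_rge0 _ (_ : 0 < 2 * (hnorm u * hnorm v))) // !mulr_gt0.
Qed.

Lemma ler_hnormD u v : hnorm (u + v) <= hnorm u + hnorm v.
Proof.
rewrite -(@ler_pXn2r _ 2) ?nnegrE ?addr_ge0 // hnorm_sqr !rdotE (rdotC v u).
by rewrite -!hnorm_sqr; have := rdot_CS u v; nra.
Qed.

Lemma ler_hnormB u v w : hnorm (u - w) <= hnorm (u - v) + hnorm (v - w).
Proof. by apply: le_trans (ler_hnormD _ _); rewrite addrA subrK. Qed.

Lemma Re_norm_hdot u v : complex.Re `|hdot H u v| <= hnorm u * hnorm v.
Proof.
set z := hdot H u v; set r := complex.Re `|z|.
have r0 : 0 <= r by rewrite /r normc_def /= sqrtr_ge0.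
have rE : `|z| = r%:C by rewrite /r RRe_real // normr_real.
have [r1|r1] := eqVneq r 0; first by rewrite r1 mulr_ge0.
(* Multiplying [u] by the conjugate of [z] rotates the product onto the real axis, which reduces the
   claim to the real inequality [rdot_CS]. *)
have h : r ^+ 2 = rdot (z^* *: u) v.
  apply: complexI; rewrite rmorphXn /= -rE /rdot hdotZl -/z mulrC -normCK.
  by rewrite rE -rmorphXn.
have := rdot_CS (z^* *: u) v; rewrite -h hnormZ norm_conjC -/r expr2 -mulrA.
by rewrite ler_pM2l // lt_def r1.
Qed.

Lemma rdot_eq0P u : (forall v, rdot u v = 0) -> u = 0.
Proof. by move=> h; apply/eqP; rewrite -rdot_eq0 h. Qed.

Lemma normr_rdot u v : `|rdot u v| <= hnorm u * hnorm v.
Proof. by rewrite ler_norml -[- _ <= _]lerN2 opprK -rdotNr -{1}(hnorm_opp v) !rdot_CS. Qed.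

(** For [u] nonzero, take [v] in [D] closer to [u] than [hnorm u]; then [|u|^2 = rdot u (u - v)]
    contradicts Cauchy-Schwarz. *)
Lemma hclosure_dense_rdot0 (D : set H) u :
  hclosure D = setT -> (forall v, D v -> rdot u v = 0) -> u = 0.
Proof.
move=> dD h; apply/eqP; rewrite -hnorm_eq0; apply/negPn/negP => u0.
have up : 0 < hnorm u by rewrite lt_def u0 /=.
have : hclosure D u by rewrite dD.
move=> /(_ _ up)[v Dv uv].
have := rdot_CS u (u - v); rewrite rdotDr rdotNr (h v Dv) oppr0 addr0 -hnorm_sqr.
by rewrite expr2 ler_pM2l // leNgt uv.
Qed.

End InnerProduct.
#[global] Hint Extern 0 (is_true (0 <= hnorm _)) => exact: hnorm_ge0 : core.

(** * Orthogonal projections and Riesz representation *)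

Section Projection.
Context {R : realType} {H : hilbertType R}.
Implicit Types (u v w : H) (t : R) (c : R[i]) (K : set H).

Lemma hilbert_cauchy_cvg (x : nat -> H) :
  (forall e : R, 0 < e -> exists N, forall m n, (N <= m)%N -> (N <= n)%N ->
     hnorm (x m - x n) < e) ->
  exists l, forall e : R, 0 < e -> exists N, forall n, (N <= n)%N ->
     hnorm (x n - l) < e.
Proof.
move=> cx; have [l /cvgrPdist_lt xl] := hilbert_complete cx.
exists l => e /xl [N _ h]; exists N => n Nn.
by have := h n Nn; rewrite sub0r normrN ger0_norm ?sqrtr_ge0.
Qed.

Lemma natSinv_lt (e : R) : 0 < e -> exists N, forall n, (N <= n)%N -> n.+1%:R^-1 < e.
Proof.
by move=> e0; have [N _ h] := near_infty_natSinv_lt (PosNum e0); exists N => n /h.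
Qed.

Lemma rdotiC u v : rdot ('i%C *: u) v = - rdot u ('i%C *: v).
Proof. by rewrite -rdotii scalerA -expr2 sqr_i scaleN1r rdotNl. Qed.

Definition csubspace K := K 0 /\ forall c u v, K u -> K v -> K (c *: u + v).

Lemma csubspaceZ K c u : csubspace K -> K u -> K (c *: u).
Proof. by move=> [K0 KL] Ku; rewrite -[_ *: _]addr0; exact: KL. Qed.

Lemma csubspaceD K u v : csubspace K -> K u -> K v -> K (u + v).
Proof. by move=> [K0 KL] Ku Kv; rewrite -[u]scale1r; exact: KL. Qed.

Lemma csubspaceB K u v : csubspace K -> K u -> K v -> K (u - v).
Proof.
by move=> sK Ku Kv; apply: csubspaceD => //; rewrite -scaleN1r; exact: csubspaceZ.
Qed.

(** A complex subspace contains ['i a] along with [a], so the real condition also controls the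
    imaginary part. *)
Lemma csubspace_hdot_eq0 K u : csubspace K -> (forall a, K a -> rdot u a = 0) ->
  forall a, K a -> hdot H u a = 0.
Proof.
move=> sK h a Ka; rewrite hdotE h // rdotiC (h _ (csubspaceZ _ sK Ka)) //.
by rewrite !oppr0.
Qed.

Lemma csubspace_hclosure K : csubspace K -> csubspace (hclosure K).
Proof.
move=> sK; split=> [e e0|c u v Ku Kv e e0].
  by exists 0; [exact: sK.1|rewrite subr0 hnorm0].
set d := complex.Re `|c| + 1.
have c0 : 0 <= complex.Re `|c| by rewrite normc_def sqrtr_ge0.
have d0 : 0 < d by rewrite /d; lra.
have [a Ka ua] := Ku (e / 2 / d) (divr_gt0 (divr_gt0 e0 (ltr0Sn _ _)) d0).
have [b Kb vb] := Kv (e / 2) (divr_gt0 e0 (ltr0Sn _ _)).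
exists (c *: a + b); first exact: sK.2.
have -> : c *: u + v - (c *: a + b) = c *: (u - a) + (v - b).
  by rewrite opprD addrACA scalerBr.
apply: le_lt_trans (ler_hnormD _ _) _; rewrite hnormZ [ltRHS](splitr e).
apply: ler_ltD => //; rewrite ltr_pdivlMr // in ua.
apply: ltW; apply: le_lt_trans ua; rewrite mulrC ler_wpM2l // /d.
by rewrite /d lerDl.
Qed.

Lemma hclosure_closed K : hclosure (hclosure K) `<=` hclosure K.
Proof.
move=> u Ku e e0; have e2 : 0 < e / 2 by lra.
have [a Ka ua] := Ku _ e2; have [b Kb ab] := Ka _ e2.
exists b => //; apply: le_lt_trans (ler_hnormB _ a _) _; lra.
Qed.

(** A minimizing sequence for the distance from [u] to [K] is Cauchy by the parallelogram law, and
    its limit is the projection. Orthogonality is proved approximately along the sequence and then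
    passed to the limit. *)
Lemma projection_exists K u : csubspace K -> hclosure K `<=` K ->
  exists p, K p /\ forall a, K a -> hdot H (u - p) a = 0.
Proof.
move=> sK cK; pose D a : R := rdot (u - a) (u - a).
pose A := [set D a | a in K].
have infA : has_inf A.
  by split; [exists (D 0), 0 => //; exact: sK.1|exists 0 => _ [a _ <-]; exact: rdot_ge0].
set d := inf A.
have dle a : K a -> d <= D a by move=> Ka; apply: ge_inf; [exact: infA.2|exists a].
have ex n : exists a, K a /\ D a < d + n.+1%:R^-1.
  have n0 : 0 < n.+1%:R^-1 :> R by rewrite invr_gt0 ltr0n.
  by have [_ [a Ka <-] h] := inf_adherent n0 infA; exists a.
have [x xP] := choice ex.
have par a b n : K a -> K b -> D a < d + n -> D b < d + n ->
    hnorm (a - b) ^+ 2 <= 4 * n.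
  (* The midpoint [m] stays in [K], hence [d <= D m]; the parallelogram identity
     [|a - b|^2 = 2 D a + 2 D b - 4 D m] then gives the bound. *)
  move=> Ka Kb aN bN; set m := (2^-1)%:C *: (a + b).
  have /dle : K m by apply: csubspaceZ => //; exact: csubspaceD.
  move: aN bN; rewrite hnorm_sqr /D /m !rdotE !(rdotC a u, rdotC b u, rdotC b a).
  lra.
have [l xl] : exists l, forall e : R, 0 < e -> exists N, forall n, (N <= n)%N ->
     hnorm (x n - l) < e.
  apply: hilbert_cauchy_cvg => e e0.
  have [N NP] := @natSinv_lt (e ^+ 2 / 4) (divr_gt0 (exprn_gt0 2 e0) (ltr0Sn _ _)).
  have xN n : (N <= n)%N -> D (x n) < d + N.+1%:R^-1.
    move=> Nn; apply: lt_le_trans (xP n).2 _; rewrite lerD2l.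
    by rewrite lef_pV2 ?posrE ?ltr0n // ler_nat ltnS.
  exists N => m n Nm Nn; rewrite -(@ltr_pXn2r _ 2) ?nnegrE // ?(ltW e0) //.
  apply: le_lt_trans (par _ _ _ (xP m).1 (xP n).1 (xN m Nm) (xN n Nn)) _.
  have := NP N (leqnn N); set q := N.+1%:R^-1; set e' := e ^+ 2 => h.
  by rewrite mulrC -ltr_pdivlMr.
exists l; split.
  apply: cK => e /xl [N NP]; exists (x N); first exact: (xP N).1.
  by rewrite hnormBC; exact: NP.
apply: csubspace_hdot_eq0 => // a Ka; apply/eqP; rewrite -normr_le0.
have [->|a0] := eqVneq a 0; first by rewrite rdot0r normr0.
have ap : 0 < hnorm a by rewrite lt_def hnorm_eq0 a0 /=.
have sqa : 0 < hnorm a ^+ 2 by rewrite exprn_gt0.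
(* The step [t = s / |a|^2] along [a] is optimal: it lowers the squared distance by [s^2 / |a|^2],
   which cannot exceed the gap [1 / (n + 1)] to the infimum. *)
have near_orth n : rdot (u - x n) a ^+ 2 <= hnorm a ^+ 2 * n.+1%:R^-1.
  set s := rdot (u - x n) a; set t := s / hnorm a ^+ 2.
  have /dle : K (x n + t%:C *: a).
    by apply: csubspaceD (xP n).1 _ => //; exact: csubspaceZ.
  have -> : D (x n + t%:C *: a) = D (x n) - 2 * t * s + t ^+ 2 * hnorm a ^+ 2.
    by rewrite hnorm_sqr /s /D !rdotE !(rdotC a u, rdotC (x n) u, rdotC a (x n)); ring.
  have -> : t ^+ 2 * hnorm a ^+ 2 = t * s by rewrite /t; field; rewrite gt_eqF.
  have ts : t * hnorm a ^+ 2 = s by rewrite /t divfK // gt_eqF.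
  have := (xP n).2 => h1 h2.
  have h3 : t * s <= n.+1%:R^-1.
    by move: h1 h2; set q := n.+1%:R^-1; set ts' := t * s => h1; rewrite -mulrA -/ts'; lra.
  by rewrite expr2 -{1}ts mulrAC mulrC ler_pM2l // mulrC.
apply/ler_addgt0Pl => e e0; rewrite addr0.
have e2 : 0 < e / 2 by lra.
have [N1 h1] := xl (e / 2 / hnorm a) (divr_gt0 e2 ap).
have [N2 h2] := @natSinv_lt ((e / 2 / hnorm a) ^+ 2) (exprn_gt0 2 (divr_gt0 e2 ap)).
set n := maxn N1 N2; have {}h1 := h1 n (leq_maxl _ _); have {}h2 := h2 n (leq_maxr _ _).
have -> : u - l = (u - x n) + (x n - l) by rewrite addrA subrK.
rewrite rdotDl; apply: le_trans (ler_normD _ _) _; rewrite [leRHS](splitr e).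
apply: lerD; last first.
  by apply: le_trans (normr_rdot _ _) _; rewrite ltr_pdivlMr // in h1; exact: ltW.
rewrite -(@ler_pXn2r _ 2) ?nnegrE ?(ltW e2) // real_normK ?num_real //.
apply: le_trans (near_orth n) _.
have -> : (e / 2) ^+ 2 = hnorm a ^+ 2 * (e / 2 / hnorm a) ^+ 2.
  by rewrite -exprMn; congr (_ ^+ 2); field; rewrite gt_eqF.
by rewrite ler_pM2l // ltW.
Qed.

Lemma orth_projP K u : csubspace K -> hclosure K `<=` K ->
  K (orth_proj K u) /\ forall a, K a -> hdot H (u - orth_proj K u) a = 0.
Proof.
move=> sK cK; have [p pP] := projection_exists u sK cK.
exact: (@xgetPex _ 0 [set p | K p /\ forall a, K a -> hdot H (u - p) a = 0] (ex_intro _ p pP)).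
Qed.

Lemma orth_proj_unique K u p : csubspace K -> hclosure K `<=` K ->
  K p -> (forall a, K a -> hdot H (u - p) a = 0) -> orth_proj K u = p.
Proof.
move=> sK cK Kp pP; have [Kq qP] := orth_projP u sK cK.
apply/eqP; rewrite -subr_eq0 -rdot_eq0; set q := orth_proj K u in Kq qP *.
have Kqp : K (q - p) by exact: csubspaceB.
have -> : rdot (q - p) (q - p) = rdot (u - p) (q - p) - rdot (u - q) (q - p).
  by rewrite !rdotE; ring.
by rewrite /rdot pP // qP // subrr.
Qed.

Lemma orth_proj_linear K c u v : csubspace K -> hclosure K `<=` K ->
  orth_proj K (c *: u + v) = c *: orth_proj K u + orth_proj K v.
Proof.
move=> sK cK; have [Ku uP] := orth_projP u sK cK; have [Kv vP] := orth_projP v sK cK.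
apply: orth_proj_unique => //; first exact: sK.2.
move=> a Ka; rewrite opprD addrACA -scalerBr hdotDl hdotZl uP // vP //.
by rewrite mulr0 addr0.
Qed.

Lemma orth_proj_id K u : csubspace K -> hclosure K `<=` K -> K u -> orth_proj K u = u.
Proof.
by move=> sK cK Ku; apply: orth_proj_unique => // a _; rewrite subrr linear0l.
Qed.

Lemma orth_proj_adjoint K u v : csubspace K -> hclosure K `<=` K ->
  hdot H (orth_proj K u) v = hdot H u (orth_proj K v).
Proof.
move=> sK cK; have [Ku uP] := orth_projP u sK cK; have [Kv vP] := orth_projP v sK cK.
have := uP _ Kv; have := vP _ Ku; rewrite !hdotBl => /subr0_eq h1 /subr0_eq ->.
by rewrite hdotC h1 -hdotC.
Qed.

(* The representing vector is a multiple of the component, orthogonal to the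
   kernel, of a vector on which the functional takes the value 1. *)
Lemma riesz (psi : H -> R[i]) (C : R) :
  (forall c u v, psi (c *: u + v) = c^* * psi u + psi v) ->
  (forall u, complex.Re `|psi u| <= C * hnorm u) ->
  exists g, forall u, psi u = hdot H g u.
Proof.
move=> psiL psib.
have psiD u v : psi (u + v) = psi u + psi v.
  by rewrite -[u in LHS]scale1r psiL rmorph1 mul1r.
have psi0 : psi 0 = 0 by apply: (addrI (psi 0)); rewrite -psiD !addr0.
have psiZ c u : psi (c *: u) = c^* * psi u by rewrite -[_ *: _]addr0 psiL psi0 addr0.
have psiB u v : psi (u - v) = psi u - psi v.
  by rewrite psiD -scaleN1r psiZ rmorphN1 mulN1r.
pose K := [set u | psi u = 0].
have sK : csubspace K by split=> // c u v; rewrite /K /= => Ku Kv; rewrite psiL Ku Kv mulr0 addr0.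
have normRe (z : R[i]) : `|z| = (complex.Re `|z|)%:C by rewrite RRe_real // normr_real.
have cK : hclosure K `<=` K.
  move=> u Ku; rewrite /K /=; apply/eqP; rewrite -normr_le0 normRe lecR.
  apply/ler_addgt0Pl => e e0; rewrite addr0.
  have C0 : 0 < `|C| + 1 by have := normr_ge0 C; lra.
  have [a Ka ua] := Ku (e / (`|C| + 1)) (divr_gt0 e0 C0).
  have -> : psi u = psi (u - a) by rewrite psiB Ka subr0.
  apply: le_trans (psib _) _; rewrite ltr_pdivlMr // in ua.
  have := hnorm_ge0 (u - a); have := ler_norm C; nra.
have [h|/existsNP [w0 w0P]] := pselect (forall u, psi u = 0).
  by exists 0 => u; rewrite h linear0l.
have {}w0P : psi w0 != 0 by apply/eqP.
(* The conjugate compensates for the conjugate-linearity of [psi] and normalizes [psi w] to 1. *)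
pose w := ((psi w0)^-1)^* *: w0.
have psiw : psi w = 1 by rewrite psiZ conjCK mulVf.
have [Kp pP] := orth_projP w sK cK; set e := w - _ in pP.
have psie : psi e = 1 by rewrite psiB psiw Kp subr0.
have e0 : e != 0 by apply/eqP => e0; have := oner_neq0 R[i]; rewrite -psie e0 psi0 eqxx.
have ee0 : hdot H e e != 0 by rewrite dnorm_eq0.
exists ((hdot H e e)^-1 *: e) => u.
have /pP : K (u - (psi u)^* *: e) by rewrite /K /= psiB psiZ psie mulr1 conjCK subrr.
rewrite hdotBr hdotZr conjCK => /subr0_eq h.
by rewrite hdotZl h mulrC mulfK.
Qed.

End Projection.

(** * Skew-adjoint operators *)

Section SkewAdjoint.
Context {R : realType} {H : hilbertType R} (K : operator H).
Hypothesis hK : closed_skew_adjoint K.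
Implicit Types (u v w x y z : H) (t : R) (c : R[i]).

Lemma csa_dom : csubspace (dom K).
Proof. by have [d0 dL] := csa_linear hK; split=> // c u v du dv; have [] := dL c u v du dv. Qed.

Lemma csaL c u v : dom K u -> dom K v -> K (c *: u + v) = c *: K u + K v.
Proof. by move=> du dv; have [_ /(_ c u v du dv) []] := csa_linear hK. Qed.

Lemma csaD u v : dom K u -> dom K v -> K (u + v) = K u + K v.
Proof. by move=> du dv; rewrite -[u in LHS]scale1r csaL // scale1r. Qed.

Lemma csa0 : K 0 = 0.
Proof. by have d0 := csa_dom.1; apply: (addrI (K 0)); rewrite -csaD // !addr0. Qed.

Lemma csaZ c u : dom K u -> K (c *: u) = c *: K u.
Proof. by have d0 := csa_dom.1; move=> du; rewrite -[_ *: u]addr0 csaL // csa0 addr0. Qed.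

Lemma csaN u : dom K u -> K (- u) = - K u.
Proof. by move=> du; rewrite -scaleN1r csaZ // scaleN1r. Qed.

Lemma csaB u v : dom K u -> dom K v -> K (u - v) = K u - K v.
Proof.
by move=> du dv; rewrite csaD ?csaN // -scaleN1r; apply: csubspaceZ => //; exact: csa_dom.
Qed.

Lemma csa_skewC u v : dom K u -> dom K v -> hdot H (K u) v = - hdot H u (K v).
Proof.
move=> du dv; have : graph (scale_op (-1) K) (v, - K v) by split=> //=; rewrite scaleN1r.
by rewrite -(csa_skew hK) => /(_ u du) /= ->; rewrite hdotNr.
Qed.

(** Since the adjoint graph is exactly that of [-K], a weak identity already yields membership in
    the domain. *)
Lemma csa_adjoint v w : (forall u, dom K u -> hdot H (K u) v = hdot H u w) ->
  dom K v /\ K v = - w.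
Proof.
move=> h; have : adjoint_graph K (v, w) by move=> u du; exact: h.
by rewrite (csa_skew hK) => -[/= dv ->]; rewrite scaleN1r opprK.
Qed.

Lemma csa_rdot u : dom K u -> rdot (K u) u = 0.
Proof.
move=> du; have : rdot (K u) u = - rdot (K u) u; last lra.
by rewrite [LHS]/rdot csa_skewC // ReN -/(rdot u (K u)) rdotC.
Qed.

Lemma csa_closedP u w : (forall e : R, 0 < e ->
    exists a, [/\ dom K a, hnorm (u - a) < e & hnorm (w - K a) < e]) ->
  dom K u /\ K u = w.
Proof.
move=> h; suff : graph K (u, w) by move=> [/= du ->].
rewrite -(csa_closed hK) => e /h [a [da ua wa]]; exists (a, K a); split=> //.
Qed.

Lemma csa_ker : csubspace (ker_op K) /\ hclosure (ker_op K) `<=` ker_op K.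
Proof.
split.
  split; first by split; [exact: csa_dom.1|exact: csa0].
  move=> c u v [du ku] [dv kv]; split; first exact: csa_dom.2.
  by rewrite csaL // ku kv scaler0 addr0.
move=> u ku; apply: csa_closedP => e /ku [a [da ka] ua]; exists a; split=> //.
by rewrite ka subr0 (le_lt_trans _ ua) // hnorm0.
Qed.

(** The cross term [rdot (K x) x] vanishes by skew-symmetry. This identity underlies the resolvent
    bound, the spectral density [l^2 + c^2] and the isometry [v |-> v - J v]. *)
Lemma hnorm_shift t x : dom K x ->
  hnorm (K x + t%:C *: x) ^+ 2 = hnorm (K x) ^+ 2 + t ^+ 2 * hnorm x ^+ 2.
Proof.
move=> dx; rewrite !hnorm_sqr !rdotE (rdotC x (K x)) csa_rdot //; ring.
Qed.

Lemma hnorm_shift_ge t x : dom K x -> `|t| * hnorm x <= hnorm (K x + t%:C *: x).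
Proof.
move=> dx; rewrite -(@ler_pXn2r _ 2) ?nnegrE ?mulr_ge0 // hnorm_shift // exprMn.
by rewrite real_normK ?num_real // lerDr sqr_ge0.
Qed.

Lemma shift_inj t x x' : t != 0 -> dom K x -> dom K x' ->
  K x + t%:C *: x = K x' + t%:C *: x' -> x = x'.
Proof.
move=> t0 dx dx' /eqP; rewrite -subr_eq0 opprD addrACA -scalerBr -csaB // => /eqP h.
have := @hnorm_shift_ge t (x - x') (csubspaceB csa_dom dx dx').
rewrite h hnorm0 pmulr_rle0 ?normr_gt0 // => h0.
by apply/eqP; rewrite -subr_eq0 -hnorm_eq0 eq_le h0 hnorm_ge0.
Qed.

(** The range of [K + t] is closed, by the lower bound [hnorm_shift_ge] and the closedness of [K]. A
    vector [w] orthogonal to it satisfies [K w = t w] by the adjoint relation, and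
    [rdot (K w) w = 0] forces [w = 0]. *)
Lemma shift_surj t y : t != 0 -> exists x, dom K x /\ K x + t%:C *: x = y.
Proof.
move=> t0; have tp : 0 < `|t| by rewrite normr_gt0.
pose N := [set z | exists x, dom K x /\ K x + t%:C *: x = z].
have sN : csubspace N.
  split; first by exists 0; split; [exact: csa_dom.1|rewrite csa0 scaler0 addr0].
  move=> c u v [a [da <-]] [b [db <-]]; exists (c *: a + b); split; first exact: csa_dom.2.
  by rewrite csaL // !scalerDr addrACA !scalerA mulrC.
have cN : hclosure N `<=` N.
  move=> z zN.
  have ex n : exists a, dom K a /\ hnorm (z - (K a + t%:C *: a)) < n.+1%:R^-1.
    have n0 : 0 < n.+1%:R^-1 :> R by rewrite invr_gt0 ltr0n.
    by have [_ [a [da <-]] h] := zN _ n0; exists a.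
  have [x xP] := choice ex; pose f a := K a + t%:C *: a.
  have fz (e : R) : 0 < e -> exists M, forall n, (M <= n)%N -> hnorm (z - f (x n)) < e.
    move=> /natSinv_lt [M MP]; exists M => n Mn.
    exact: lt_trans (xP n).2 (MP n Mn).
  have [l lP] : exists l, forall e : R, 0 < e -> exists N, forall n, (N <= n)%N ->
     hnorm (x n - l) < e.
    apply: hilbert_cauchy_cvg => e e0.
    have [M MP] := fz (e * `|t| / 2) (divr_gt0 (mulr_gt0 e0 tp) (ltr0Sn _ _)).
    exists M => m n Mm Mn; rewrite -(ltr_pM2l tp).
    apply: le_lt_trans (hnorm_shift_ge t (csubspaceB csa_dom (xP m).1 (xP n).1)) _.
    have -> : K (x m - x n) + t%:C *: (x m - x n) = f (x m) - f (x n).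
      by rewrite (csaB (xP m).1 (xP n).1) scalerBr /f opprD addrACA.
    apply: le_lt_trans (ler_hnormB _ z _) _; rewrite hnormBC.
    have := MP m Mm; have := MP n Mn; lra.
  have [dl Kl] : dom K l /\ K l = z - t%:C *: l.
    apply: csa_closedP => e e0.
    have e2 : 0 < e / 2 by lra.
    have t1 : 0 < `|t| + 1 by lra.
    have [N1 h1] := lP (e / 2 / (`|t| + 1)) (divr_gt0 e2 t1).
    have [N2 h2] := fz (e / 2) e2.
    set n := maxn N1 N2; have {}h1 := h1 n (leq_maxl _ _); have {}h2 := h2 n (leq_maxr _ _).
    move: h1; rewrite ltr_pdivlMr // => h1.
    have hx := hnorm_ge0 (x n - l).
    exists (x n); split; first exact: (xP n).1.
      by rewrite hnormBC; nra.
    have -> : z - t%:C *: l - K (x n) = (z - f (x n)) + t%:C *: (x n - l).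
      by rewrite /f scalerBr opprD addrA addrA subrK addrAC.
    by apply: le_lt_trans (ler_hnormD _ _) _; rewrite hnormZr; nra.
  by exists l; split => //; rewrite Kl subrK.
have [p [Np pP]] := projection_exists y sN cN.
suff h : y - p = 0 by move: Np; rewrite -(subr0_eq h).
set w := y - p in pP *.
have [dw Kw] : dom K w /\ K w = - - (t%:C *: w).
  apply: csa_adjoint => u du; have : hdot H w (K u + t%:C *: u) = 0 by apply: pP; exists u.
  rewrite hdotDr => /eqP; rewrite addr_eq0 => /eqP h.
  by rewrite hdotC h hdotZr hdotNr hdotZr rmorphN rmorphM /= conjCK -hdotC real_complex_conj.
have := csa_rdot dw; rewrite Kw opprK rdotZl => /eqP.
by rewrite mulf_eq0 (negbTE t0) rdot_eq0 => /eqP.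
Qed.

Lemma resolventP t y : t != 0 ->
  dom K (resolvent K t y) /\ K (resolvent K t y) + t%:C *: resolvent K t y = y.
Proof.
move=> t0; have [x xP] := shift_surj y t0.
exact: (@xgetPex _ 0 [set x | dom K x /\ K x + t%:C *: x = y] (ex_intro _ x xP)).
Qed.

Lemma dom_resolvent t y : t != 0 -> dom K (resolvent K t y).
Proof. by move=> t0; have [] := resolventP y t0. Qed.

Lemma resolventK t y : t != 0 -> K (resolvent K t y) + t%:C *: resolvent K t y = y.
Proof. by move=> t0; have [] := resolventP y t0. Qed.

Lemma app_resolvent t y : t != 0 -> K (resolvent K t y) = y - t%:C *: resolvent K t y.
Proof. by move=> t0; rewrite -{2}(resolventK y t0) addrK. Qed.

Lemma shiftK t x : t != 0 -> dom K x -> resolvent K t (K x + t%:C *: x) = x.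
Proof.
by move=> t0 dx; apply: (shift_inj t0) => //; [exact: dom_resolvent|exact: resolventK].
Qed.

Lemma resolvent_linear t c u v : t != 0 ->
  resolvent K t (c *: u + v) = c *: resolvent K t u + resolvent K t v.
Proof.
move=> t0; have [du eu] := resolventP u t0; have [dv ev] := resolventP v t0.
rewrite -[RHS](shiftK t0); last exact: csa_dom.2.
congr resolvent; rewrite csaL // scalerDr addrACA.
by rewrite -{1}eu -{1}ev !scalerDr !scalerA [t%:C * c]mulrC.
Qed.

Lemma hnorm_resolvent t y : t != 0 -> hnorm (resolvent K t y) <= `|t|^-1 * hnorm y.
Proof.
move=> t0; have := @hnorm_shift_ge t _ (dom_resolvent y t0).
by rewrite resolventK // => h; rewrite mulrC ler_pdivlMr ?normr_gt0 // mulrC.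
Qed.

(** The adjoint of [K + t] is [-K + t = -(K - t)], whence the two signs on the right. *)
Lemma resolvent_adjoint t y z : t != 0 ->
  hdot H (resolvent K t y) z = hdot H y (- resolvent K (- t) z).
Proof.
move=> t0; have Nt0 : - t != 0 by rewrite oppr_eq0.
have [dx ex] := resolventP y t0; have [dw ew] := resolventP z Nt0.
rewrite -{1}ew -{2}ex !(hdotDr, hdotDl, hdotNr, hdotZl, hdotZr) csa_skewC //.
rewrite !real_complex_conj; rewrite (rmorphN (real_complex R)) /=; ring.
Qed.

End SkewAdjoint.

(** * Measures with densities *)

Section Density.
Local Open Scope ereal_scope.
Context d (T : measurableType d) (R : realType).
Variables (mu : {measure set T -> \bar R}) (h : T -> R).
Hypotheses (h0 : forall x, (0 <= h x)%R) (mh : measurable_fun setT h).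

(** The proofs of nonnegativity and measurability are arguments so that a measure structure can be
    attached to this set function. *)
Definition density of (forall x, (0 <= h x)%R) & measurable_fun setT h :=
  fun A : set T => \int[mu]_(x in A) (h x)%:E.
Local Notation nu := (density h0 mh).

Let nu0 : nu set0 = 0. Proof. exact: integral_set0. Qed.

Let nu_ge0 A : 0 <= nu A. Proof. by apply: integral_ge0 => x _; rewrite lee_fin. Qed.

Let nu_sigma_additive : semi_sigma_additive nu.
Proof.
apply: semi_sigma_additive_nng_induced; first exact/measurable_EFinP.
by move=> x; rewrite lee_fin.
Qed.

HB.instance Definition _ := isMeasure.Build _ _ _ nu nu0 nu_ge0 nu_sigma_additive.

Import HBNNSimple.

(** Monotone convergence along simple functions increasing to [f], applied on both sides, reduces
    the claim to indicators, where it is the definition of the density. *)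
Lemma integral_density (f : T -> R) : (forall x, (0 <= f x)%R) ->
  measurable_fun setT f ->
  \int[nu]_x (f x)%:E = \int[mu]_x (f x * h x)%:E.
Proof.
move=> f0 mf.
have mEf : measurable_fun setT (EFin \o f) by exact/measurable_EFinP.
pose g := nnsfun_approx measurableT mEf.
have gcvg x : (EFin \o g n) x @[n --> \oo] --> (f x)%:E.
  by apply: cvg_nnsfun_approx => // y _; rewrite lee_fin.
have gnd x : {homo (fun n => (g n x)) : n m / (n <= m)%N >-> (n <= m)%R}.
  by move=> n m nm; exact/lefP/nd_nnsfun_approx.
have mg n : measurable_fun setT (g n) by exact/measurable_funP.
transitivity (lim (\int[nu]_x (g n x)%:E @[n --> \oo])).
  rewrite -monotone_convergence//.
  - by apply: eq_integral => x _; apply/esym/cvg_lim => //; exact: gcvg.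
  - by move=> n; exact/measurable_EFinP.
  - by move=> n x _; rewrite lee_fin.
  - by move=> x _ n m nm; rewrite lee_fin gnd.
transitivity (lim (\int[mu]_x (g n x * h x)%:E @[n --> \oo])); last first.
  rewrite -monotone_convergence//.
  - apply: eq_integral => x _; apply/cvg_lim => //.
    under eq_fun do rewrite EFinM.
    by rewrite EFinM; apply: cvgeZr => //; exact: gcvg.
  - by move=> n; apply/measurable_EFinP; exact: measurable_funM.
  - by move=> n x _; rewrite lee_fin mulr_ge0.
  - by move=> x _ n m nm; rewrite lee_fin ler_wpM2r // gnd.
suff suf n : \int[nu]_x (g n x)%:E = \int[mu]_x (g n x * h x)%:E.
  by under eq_fun do rewrite suf.
transitivity (\int[nu]_x (\sum_(y \in range (g n)) (y * \1_(g n @^-1` [set y]) x)%:E)).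
  by apply: eq_integral => t _; rewrite /= fimfunE -fsumEFin.
rewrite ge0_integral_fsum//; last 2 first.
- by move=> y; apply/measurable_EFinP; exact: measurable_funM.
- by move=> m y _; exact: nnfun_muleindic_ge0.
transitivity (\int[mu]_x (\sum_(y \in range (g n))
    (y * \1_(g n @^-1` [set y]) x)%:E * (h x)%:E)); last first.
  apply: eq_integral => x _.
  rewrite -ge0_mule_fsuml => [|y]; last exact: nnfun_muleindic_ge0.
  by rewrite fsumEFin // -(fimfunE _ x) EFinM.
rewrite ge0_integral_fsum//; last 2 first.
- move=> y; apply: emeasurable_funM => //; apply/measurable_EFinP => //.
  exact: measurable_funM.
- by move=> m y _; apply: mule_ge0; [exact: nnfun_muleindic_ge0|rewrite lee_fin].
apply: eq_fsbigr => r rgn.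
under eq_integral do rewrite EFinM.
rewrite integralZl_indic_nnsfun => //.
under [RHS]eq_integral do rewrite EFinM -muleA.
rewrite ge0_integralZl//.
- rewrite integral_indic // setIT; congr (_ * _).
  transitivity (\int[mu]_(x in g n @^-1` [set r]) (h x)%:E); first by [].
  rewrite integral_mkcond.
  apply: eq_integral => x _; rewrite patchE indicE.
  by case: ifPn => _; rewrite ?mul1e ?mul0e.
- apply: emeasurable_funM; exact/measurable_EFinP.
- by move=> t Et; rewrite mule_ge0 ?lee_fin.
- by move: rgn; rewrite inE => -[t _ <-]; rewrite lee_fin.
Qed.

End Density.

Section MeasureComparison.
Local Open Scope ereal_scope.
Context d (T : measurableType d) (R : realType).

(** The hypothesis expresses that [mu1 - mu2] has the signed density [h2 - h1] with respect to [nu],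
    written with sums so that only nonnegative measures occur. *)
Lemma integral_add_density (mu1 mu2 nu : {measure set T -> \bar R}) (h1 h2 f : T -> R) :
  (forall x, 0 <= h1 x)%R -> (forall x, 0 <= h2 x)%R -> (forall x, 0 <= f x)%R ->
  measurable_fun setT h1 -> measurable_fun setT h2 -> measurable_fun setT f ->
  (forall C, measurable C ->
     mu1 C + \int[nu]_(x in C) (h1 x)%:E = mu2 C + \int[nu]_(x in C) (h2 x)%:E) ->
  \int[mu1]_x (f x)%:E + \int[nu]_x (f x * h1 x)%:E =
  \int[mu2]_x (f x)%:E + \int[nu]_x (f x * h2 x)%:E.
Proof.
move=> h10 h20 f0 mh1 mh2 mf h.
rewrite -(integral_density nu h10 mh1) // -(integral_density nu h20 mh2) //.
have f0' x : setT x -> 0 <= (f x)%:E by rewrite lee_fin.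
have mf' : measurable_fun setT (fun x => (f x)%:E) by exact/measurable_EFinP.
rewrite -!ge0_integral_measure_add //.
by apply: eq_measure_integral => A mA _; rewrite [LHS]measure_addE [RHS]measure_addE; exact: h.
Qed.

Lemma integral_eq_density (mu nu : {measure set T -> \bar R}) (h f : T -> R) :
  (forall x, 0 <= h x)%R -> (forall x, 0 <= f x)%R ->
  measurable_fun setT h -> measurable_fun setT f ->
  (forall C, measurable C -> mu C = \int[nu]_(x in C) (h x)%:E) ->
  \int[mu]_x (f x)%:E = \int[nu]_x (f x * h x)%:E.
Proof.
move=> h0 f0 mh mf h1; rewrite -(integral_density nu h0 mh) //.
by apply: eq_measure_integral => A mA _; exact: h1.
Qed.

End MeasureComparison.

(** * Spectral measures *)

Section SpectralMass.
Context {R : realType} {H : hilbertType R} (E : set R -> H -> H).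
Hypothesis hE : projection_valued_measure E.
Implicit Types (u v w x y z : H) (B C : set R).

Lemma pvmB B u v : measurable B -> E B (u - v) = E B u - E B v.
Proof.
move=> mB; rewrite addrC -scaleN1r (pvm_linear hE mB) scaleN1r; exact: addrC.
Qed.

Lemma pvmD B u v : measurable B -> E B (u + v) = E B u + E B v.
Proof. by move=> mB; rewrite -[u in LHS]scale1r (pvm_linear hE mB) scale1r. Qed.

Lemma pvm0 B : measurable B -> E B 0 = 0.
Proof. by move=> mB; rewrite -[X in E B X](subrr 0) pvmB // subrr. Qed.

Lemma pvmZ B c u : measurable B -> E B (c *: u) = c *: E B u.
Proof. by move=> mB; rewrite -[X in E B X]addr0 (pvm_linear hE mB) pvm0 // addr0. Qed.

Lemma pvm_rdotC B u v : measurable B -> rdot (E B u) v = rdot u (E B v).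
Proof. by move=> mB; rewrite /rdot (pvm_self_adjoint hE mB). Qed.

Lemma pvm_idem B u : measurable B -> E B (E B u) = E B u.
Proof. by move=> mB; rewrite -(pvm_setI hE mB mB) setIid. Qed.

Lemma pvm_sqr B u : measurable B -> hnorm (E B u) ^+ 2 = rdot (E B u) u.
Proof. by move=> mB; rewrite hnorm_sqr pvm_rdotC // pvm_idem // rdotC. Qed.

Lemma pvm_rdot B u v : measurable B -> rdot (E B u) (E B v) = rdot (E B u) v.
Proof. by move=> mB; rewrite -pvm_rdotC // pvm_idem. Qed.

Lemma hnorm_pvm B u : measurable B -> hnorm (E B u) <= hnorm u.
Proof.
move=> mB; have := rdot_CS (E B u) u; rewrite -pvm_sqr //.
have [->|h] := eqVneq (hnorm (E B u)) 0; first by rewrite hnorm_ge0.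
by rewrite expr2 ler_pM2l // lt_def h hnorm_ge0.
Qed.

Lemma pvm_sqrD B u v : measurable B ->
  hnorm (E B (u + v)) ^+ 2 = hnorm (E B u) ^+ 2 + hnorm (E B v) ^+ 2 + 2 * rdot (E B u) v.
Proof.
move=> mB; rewrite pvmD // !hnorm_sqr !rdotE (rdotC (E B v) (E B u)) (pvm_rdot u v) //.
ring.
Qed.

Lemma pvm_sqrB B u v : measurable B ->
  hnorm (E B (u - v)) ^+ 2 = hnorm (E B u) ^+ 2 + hnorm (E B v) ^+ 2 - 2 * rdot (E B u) v.
Proof.
move=> mB; rewrite pvmB // !hnorm_sqr !rdotE (rdotC (E B v) (E B u)) (pvm_rdot u v) //.
ring.
Qed.

(** The hypothesis on [E] becomes an argument of [spectral_mass], so that a measure structure can be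
    attached. *)
Definition smass of projection_valued_measure E := fun u => spectral_mass E u.
Local Notation mu := (smass hE).

Let mu0 u : mu u set0 = 0%E.
Proof. by rewrite /smass /spectral_mass (pvm_set0 hE) hnorm0 expr0n. Qed.

Let mu_ge0 u B : (0 <= mu u B)%E.
Proof. by rewrite lee_fin sqr_ge0. Qed.

Let mu_sigma_additive u : semi_sigma_additive (mu u).
Proof.
move=> F mF tF mUF; rewrite /smass /spectral_mass.
(* Because [|E_B u|^2 = rdot (E_B u) u] is linear in the projection, convergence of the vector sums
   gives convergence of the masses. *)
have sumE n : (\sum_(0 <= k < n) (hnorm (E (F k) u) ^+ 2)%:E =
    (rdot (\sum_(0 <= k < n) E (F k) u) u)%:E)%E.
  elim: n => [|n IH]; first by rewrite !big_nil rdot0l.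
  by rewrite !big_nat_recr //= IH rdotDl EFinD pvm_sqr.
under eq_fun do rewrite sumE.
rewrite (pvm_sqr _ mUF); apply: cvg_EFin; first by near=> n.
apply/cvgrPdist_le => e e0.
have := pvm_sigma_additive hE mF tF u => /cvgrPdist_lt cE.
have u1 : 0 < hnorm u + 1 by rewrite ltr_wpDl.
have [N _ h] := cE (e / (hnorm u + 1)) (divr_gt0 e0 u1).
exists N => // n Nn /=; have := h n Nn; rewrite sub0r normrN ger0_norm //.
rewrite ltr_pdivlMr // -rdotNl -rdotDl => h1.
apply: le_trans (normr_rdot _ _) _; apply: le_trans (ltW h1).
by rewrite ler_wpM2l // lerDl.
Unshelve. all: by end_near. Qed.

HB.instance Definition _ u :=
  isMeasure.Build _ _ _ (mu u) (mu0 u) (mu_ge0 u) (@mu_sigma_additive u).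

Lemma smassE u B : mu u B = (hnorm (E B u) ^+ 2)%:E.
Proof. by []. Qed.

Lemma smassT u : mu u setT = (hnorm u ^+ 2)%:E.
Proof. by rewrite smassE (pvm_setT hE). Qed.

Lemma integral_smass_cst u (k : R) : (\int[mu u]_l k%:E = (k * hnorm u ^+ 2)%:E)%E.
Proof. by rewrite integral_cst // [X in (_ * X)%E]smassT -EFinM. Qed.

(** The measure of [E B u] is the restriction of the measure of [u] to [B]: its density is the
    indicator of [B], by multiplicativity of [E] on intersections. *)
Lemma integral_smass_pvm B u (f : R -> R) : measurable B ->
  (forall l, 0 <= f l) -> measurable_fun setT f ->
  (\int[mu (E B u)]_l (f l)%:E = \int[mu u]_(l in B) (f l)%:E)%E.
Proof.
move=> mB f0 mf.
rewrite (integral_eq_density (nu := mu u) (h := \1_B)) //.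
- rewrite [RHS]integral_mkcond; apply: eq_integral => l _.
  by rewrite patchE indicE; case: ifPn => _; rewrite ?mulr1 ?mulr0.
by move=> C mC; rewrite integral_indic // /= !smassE -(pvm_setI hE) // setIC.
Qed.

End SpectralMass.

(** * Moments of the spectral measure of a skew-adjoint operator *)

Section SpectralMeasure.
Context {R : realType} {H : hilbertType R} (K : operator H) (E : set R -> H -> H).
Hypotheses (hK : closed_skew_adjoint K)
  (hE : spectral_measure_of (scale_op (- 'i%C) K) E).
Implicit Types (u v w x y z : H) (B C : set R).

Let pE : projection_valued_measure E.
Proof. by case: hE. Qed.

Local Notation mu := (smass pE).

Definition selfadj u : H := - 'i%C *: K u.
Local Notation A := selfadj.

Lemma measurable_sqr : measurable_fun [set: R] (fun l : R => l ^+ 2).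
Proof. exact: measurable_funX. Qed.

Lemma dom_smass u : dom K u <-> (\int[mu u]_l (l ^+ 2)%:E < +oo)%E.
Proof. by case: hE => _ /= -> _. Qed.

Lemma rdot_smass u : dom K u -> rdot (A u) u = fine (\int[mu u]_l l%:E)%E.
Proof. by move=> du; case: hE => _ _ /(_ u du) /= h; rewrite /rdot h. Qed.

Lemma selfadjD u v : dom K u -> dom K v -> A (u + v) = A u + A v.
Proof. by move=> du dv; rewrite /A (csaD hK) // scalerDr. Qed.

Lemma selfadjB u v : dom K u -> dom K v -> A (u - v) = A u - A v.
Proof. by move=> du dv; rewrite /A (csaB hK) // scalerBr. Qed.

Lemma selfadjC u v : dom K u -> dom K v -> rdot (A u) v = rdot u (A v).
Proof.
move=> du dv; rewrite /A !scaleNr rdotNl rdotNr rdotiC /rdot -!ReN -hdotNr.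
rewrite !hdotNr hdotZr hdotZr (csa_skewC hK) //.
by rewrite opprK mulrN.
Qed.

Lemma app_selfadj u : K u = 'i%C *: A u.
Proof. by rewrite /A scalerA mulrN -expr2 sqr_i opprK scale1r. Qed.

Lemma hnorm_selfadj u : hnorm (A u) = hnorm (K u).
Proof.
apply/eqP; rewrite -(@eqrXn2 _ 2) // !hnorm_sqr.
by rewrite /A scaleNr rdotNl rdotNr opprK rdotii.
Qed.

Lemma dom_selfadj u : dom K (K u) -> dom K (A u).
Proof. by move=> du; apply: csubspaceZ => //; exact: csa_dom. Qed.

Lemma polarization u v : dom K u -> dom K v ->
  4 * rdot (A u) v = rdot (A (u + v)) (u + v) - rdot (A (u - v)) (u - v).
Proof.
move=> du dv; rewrite selfadjD // selfadjB // !rdotE (rdotC (A v) u) -selfadjC //.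
ring.
Qed.

(** The bound [|l| <= 1 + l^2] combines the finite total mass with the finite second moment. *)
Lemma integrable_smass u : dom K u -> (mu u).-integrable setT (fun l : R => l%:E).
Proof.
move=> /dom_smass i2; apply/integrableP; split; first exact/measurable_EFinP.
apply: (@le_lt_trans _ _ (\int[mu u]_l (1%:E + (l ^+ 2)%:E))%E).
  apply: ge0_le_integral => //.
  - by apply: measurableT_comp => //; exact/measurable_EFinP.
  - apply/measurable_EFinP; apply: measurable_funD => //; exact: measurable_sqr.
  - move=> l _; rewrite lee_fin -[l ^+ 2]real_normK ?num_real //.
    by have := sqr_ge0 (`|l| - 1); have := normr_ge0 l; nra.
rewrite ge0_integralD //.
- by rewrite integral_smass_cst lte_add_pinfty // ltry.
- by move=> l _; rewrite lee_fin sqr_ge0.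
- by apply/measurable_EFinP; exact: measurable_sqr.
Qed.

Lemma integral_smass u : dom K u -> (\int[mu u]_l l%:E = (rdot (A u) u)%:E)%E.
Proof.
move=> du; rewrite rdot_smass // fineK //.
by apply: integrable_fin_num => //; exact: integrable_smass.
Qed.

(** * Bounded operators commuting with the spectral measure *)

Section Commutant.
Variables (T T' : H -> H) (k : R).
Hypotheses (TZ : forall c u, T (c *: u) = c *: T u)
  (TT' : forall u v, rdot (T u) v = rdot u (T' v))
  (Tk : forall u, hnorm (T u) <= k * hnorm u)
  (TE : forall B, measurable B -> forall u, E B (T u) = T (E B u)).

(** From [|T' u|^2 = rdot (T (T' u)) u <= k |T' u| |u|], divide by [|T' u|] when it is nonzero. *)
Let T'k u : hnorm (T' u) <= k * hnorm u.
Proof.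
have := rdot_CS (T (T' u)) u; rewrite TT' -hnorm_sqr => h.
have h2 := Tk (T' u); have h0 := hnorm_ge0 u; have h1 := hnorm_ge0 (T' u).
have [->|n0] := eqVneq (hnorm (T' u)) 0.
  have [->|u0] := eqVneq (hnorm u) 0; first by rewrite mulr0.
  have up : 0 < hnorm u by rewrite lt_def u0.
  by have := le_trans (hnorm_ge0 _) (Tk u).
have p : 0 < hnorm (T' u) by rewrite lt_def n0.
rewrite -(ler_pM2r p) -expr2; apply: le_trans h _; nra.
Qed.

Let T'E B : measurable B -> forall u, E B (T' u) = T' (E B u).
Proof.
move=> mB u; apply/eqP; rewrite -subr_eq0; apply/eqP/rdot_eq0P => v.
rewrite rdotDl rdotNl (pvm_rdotC pE) // (rdotC (T' u)) -TT' (rdotC (T' _)) -TT'.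
by rewrite -(pvm_rdotC pE) // TE // subrr.
Qed.

(** Commutation gives [|E_B (S x)|^2 <= k^2 |E_B x|^2], so the measure of [S x] is dominated by
    [k^2] times that of [x] and its second moment is finite. It is applied both to [T] and to its
    adjoint [T']. *)
Let bounded_commute_dom (S : H -> H) :
  (forall u, hnorm (S u) <= k * hnorm u) ->
  (forall B, measurable B -> forall u, E B (S u) = S (E B u)) ->
  forall x, dom K x -> dom K (S x).
Proof.
move=> Sk SE x /dom_smass dx; apply/dom_smass.
have k2 (l : R) : 0 <= k ^+ 2 by rewrite sqr_ge0.
have mk : measurable_fun [set: R] (fun _ : R => k ^+ 2) by [].
apply: (@le_lt_trans _ _ (\int[density (mu x) k2 mk]_l (l ^+ 2)%:E)%E).
  apply: ge0_le_measure_integral => //.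
  - move=> C mC; rewrite /= /density integral_cst // !smassE -EFinM lee_fin SE //.
    by rewrite -exprMn_comm ?ler_pXn2r ?nnegrE ?(le_trans _ (Sk _)) //; exact: mulrC.
  - by move=> l; rewrite lee_fin sqr_ge0.
  - by apply/measurable_EFinP; exact: measurable_sqr.
rewrite integral_density //; last by move=> l; rewrite sqr_ge0.
under eq_integral do rewrite EFinM.
rewrite ge0_integralZr // ?lee_fin ?sqr_ge0 //.
- rewrite lte_mul_pinfty //.
  + by apply: integral_ge0 => l _; rewrite lee_fin sqr_ge0.
  + by rewrite ge0_fin_numE // integral_ge0 // => l _; rewrite lee_fin sqr_ge0.
  + by rewrite ltry.
- by apply/measurable_EFinP; exact: measurable_sqr.
- by move=> l _; rewrite lee_fin sqr_ge0.
Qed.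

(** Tested against [v] in the dense domain, the claim reads [rdot (A (T x)) v = rdot (A x) (T' v)];
    polarization expresses both sides by quadratic forms, which the spectral measure determines. *)
Lemma commutant_selfadj x : dom K x -> dom K (T x) /\ K (T x) = T (K x).
Proof.
move=> dx; have dTx : dom K (T x) by exact: bounded_commute_dom Tk TE _ dx.
split=> //.
suff h : A (T x) = T (A x) by rewrite app_selfadj h -TZ -app_selfadj.
apply/eqP; rewrite -subr_eq0; apply/eqP.
apply: (hclosure_dense_rdot0 (csa_dense hK)) => v dv.
have dT'v : dom K (T' v) by exact: bounded_commute_dom T'k T'E _ dv.
rewrite rdotDl rdotNl TT'.
have D u w : dom K u -> dom K w -> dom K (u + w) by apply: csubspaceD; exact: csa_dom.
have DB u w : dom K u -> dom K w -> dom K (u - w) by apply: csubspaceB; exact: csa_dom.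
(* The two sums of measures coincide: their cross terms [rdot (E_C (T x)) v] and
   [rdot (E_C x) (T' v)] are equal. Placing the differences on opposite sides avoids signed
   measures. *)
have : (\int[mu (T x + v)]_l l%:E + \int[mu (x - T' v)]_l l%:E =
        \int[mu (x + T' v)]_l l%:E + \int[mu (T x - v)]_l l%:E)%E.
  rewrite -!integral_measure_add ?integrable_smass //; [ | auto..].
  apply: eq_measure_integral => C mC _.
  rewrite [LHS]measure_addE [RHS]measure_addE /= !smassE -!EFinD; congr EFin.
  rewrite !(pvm_sqrB pE) // !(pvm_sqrD pE) // TE // TT'; ring.
rewrite !integral_smass //; [|auto..]; rewrite -!EFinD => -[h].
have := polarization dTx dv; have := polarization dx dT'v; lra.
Qed.

End Commutant.


Lemma pvm_app B x : measurable B -> dom K x -> dom K (E B x) /\ K (E B x) = E B (K x).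
Proof.
move=> mB; apply: (commutant_selfadj (T' := E B) (k := 1)).
- by move=> c u; exact: pvmZ.
- by move=> u v; exact: pvm_rdotC.
- by move=> u; rewrite mul1r; exact: hnorm_pvm.
- by move=> C mC u; rewrite -!(pvm_setI pE) // setIC.
Qed.

Lemma pvm_selfadj B x : measurable B -> dom K x -> A (E B x) = E B (A x).
Proof. by move=> mB dx; have [_ h] := pvm_app mB dx; rewrite /A h pvmZ. Qed.

(** The signed density [l] is split into nonnegative parts, as [integral_add_density] requires. *)
Let pos (l : R) := Num.max l 0.
Let neg (l : R) := Num.max (- l) 0.

Let posneg l : l = pos l - neg l.
Proof. by rewrite /pos /neg; case: (lerP l 0) => h; case: (lerP (- l) 0) => h'; lra. Qed.

Let posneg0 l : pos l * neg l = 0.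
Proof. by rewrite /pos /neg; case: (lerP l 0) => h; case: (lerP (- l) 0) => h'; lra. Qed.

Let pos0 l : 0 <= pos l. Proof. by rewrite /pos le_max lexx orbT. Qed.
Let neg0 l : 0 <= neg l. Proof. by rewrite /neg le_max lexx orbT. Qed.

Let mpos : measurable_fun [set: R] pos.
Proof. exact: measurable_maxr. Qed.

Let mneg : measurable_fun [set: R] neg.
Proof. exact: measurable_maxr. Qed.

Let posE : ((fun l : R => l%:E) ^\+)%E = (fun l => (pos l)%:E).
Proof. by apply/funext => l; rewrite /pos EFin_max funepos.unlock. Qed.

Let negE : ((fun l : R => l%:E) ^\-)%E = (fun l => (neg l)%:E).
Proof. by apply/funext => l; rewrite /neg EFin_max EFinN funeneg.unlock. Qed.

Let fin_pos u : dom K u -> (\int[mu u]_l (pos l)%:E)%E \is a fin_num.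
Proof.
move=> /integrable_smass i; have := integrable_funepos measurableT i; rewrite posE.
exact: integrable_fin_num.
Qed.

Let fin_neg u : dom K u -> (\int[mu u]_l (neg l)%:E)%E \is a fin_num.
Proof.
move=> /integrable_smass i; have := integrable_funeneg measurableT i; rewrite negE.
exact: integrable_fin_num.
Qed.

Let Ip u := fine (\int[mu u]_l (pos l)%:E)%E.
Let In u := fine (\int[mu u]_l (neg l)%:E)%E.

Let rdot_posneg u : dom K u -> rdot (A u) u = Ip u - In u.
Proof.
move=> du; apply: EFin_inj; rewrite -integral_smass // EFinB !fineK ?fin_pos ?fin_neg //.
by rewrite integralE posE negE.
Qed.

(* The measures of [x + A x] and [x - A x] differ by [4 l d(mu x)], so that the
   difference of their first moments is [4 \int l^2 d(mu x)]. *)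
Lemma integral_sqr_smass x : dom K x -> dom K (K x) ->
  (\int[mu x]_l (l ^+ 2)%:E = (hnorm (K x) ^+ 2)%:E)%E.
Proof.
move=> dx dKx; have dAx := dom_selfadj dKx.
have dp : dom K (x + A x) by apply: csubspaceD => //; exact: csa_dom.
have dm : dom K (x - A x) by apply: csubspaceB => //; exact: csa_dom.
have h40 (h : R -> R) : (forall l, 0 <= h l) -> forall l, 0 <= 4 * h l.
  by move=> h0 l; rewrite mulr_ge0.
have mh4 (h : R -> R) : measurable_fun setT h -> measurable_fun setT (fun l => 4 * h l).
  by move=> mh; exact: measurable_funM.
(* The masses of [C] differ by [4 rdot (E_C x) (A x)]. Since [E C] commutes with [A], this is four
   times the quadratic form of [A] at [E_C x], that is, [4 l] integrated over [C]. *)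
have key C : measurable C ->
    (mu (x + A x) C + \int[mu x]_(l in C) (4 * neg l)%:E =
     mu (x - A x) C + \int[mu x]_(l in C) (4 * pos l)%:E)%E.
  move=> mC; rewrite -(integral_smass_pvm pE x mC (h40 _ neg0) (mh4 _ mneg)).
  rewrite -(integral_smass_pvm pE x mC (h40 _ pos0) (mh4 _ mpos)).
  have [dEx _] := pvm_app mC dx.
  have int4 (h : R -> R) : (forall l, 0 <= h l) -> measurable_fun setT h ->
      (\int[mu (E C x)]_l (4 * h l)%:E = 4%:E * \int[mu (E C x)]_l (h l)%:E)%E.
    move=> h0 mh; under eq_integral do rewrite EFinM.
    rewrite ge0_integralZl_EFin //; last exact/measurable_EFinP.
    by move=> l _; rewrite lee_fin.
  rewrite !int4 // -[X in (4%:E * X)%E]fineK ?fin_neg //.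
  rewrite -[X in (_ = _ + 4%:E * X)%E]fineK ?fin_pos // /= !smassE -!EFinM -!EFinD.
  congr EFin; rewrite (pvm_sqrD pE) // (pvm_sqrB pE) //.
  have := rdot_posneg dEx; rewrite pvm_selfadj // (pvm_rdot pE) // (pvm_rdotC pE) //.
  rewrite rdotC /Ip /In; lra.
have sqrE : (\int[mu x]_l (l ^+ 2)%:E =
    \int[mu x]_l (pos l ^+ 2)%:E + \int[mu x]_l (neg l ^+ 2)%:E)%E.
  rewrite -ge0_integralD //.
  - apply: eq_integral => l _; rewrite -EFinD; congr EFin.
    rewrite {1}(posneg l) sqrrB posneg0 mul0rn subr0 //.
  - by move=> l _; rewrite lee_fin sqr_ge0.
  - by apply/measurable_EFinP; exact: measurable_funX.
  - by move=> l _; rewrite lee_fin sqr_ge0.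
  - by apply/measurable_EFinP; exact: measurable_funX.
have i2 := (dom_smass x).1 dx.
have ge02 (h : R -> R) : (0 <= \int[mu x]_l (h l ^+ 2)%:E)%E.
  by apply: integral_ge0 => l _; rewrite lee_fin sqr_ge0.
have fp2 : (\int[mu x]_l (pos l ^+ 2)%:E)%E \is a fin_num.
  by rewrite ge0_fin_numE //; apply: le_lt_trans i2; rewrite sqrE leeDl.
have fn2 : (\int[mu x]_l (neg l ^+ 2)%:E)%E \is a fin_num.
  by rewrite ge0_fin_numE //; apply: le_lt_trans i2; rewrite sqrE leeDr.
have int42 (h : R -> R) : measurable_fun setT h ->
    (\int[mu x]_l (h l * (4 * h l))%:E = 4%:E * \int[mu x]_l (h l ^+ 2)%:E)%E.
  move=> mh; under eq_integral do rewrite mulrCA -expr2 EFinM.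
  rewrite ge0_integralZl_EFin //; last by apply/measurable_EFinP; exact: measurable_funX.
  by move=> l _; rewrite lee_fin sqr_ge0.
have int0 (h h' : R -> R) : (forall l, h l * h' l = 0) ->
    (\int[mu x]_l (h l * (4 * h' l))%:E = 0)%E.
  by move=> hh; apply: integral0_eq => l _; rewrite mulrCA hh mulr0.
(* Integrating [pos] and then [neg] against [key] leaves one square each, as [pos * neg = 0]. The
   two results combine through polarization of [x] and [A x]. *)
have := @integral_add_density _ _ _ (mu (x + A x)) (mu (x - A x)) (mu x)
  _ _ _ (h40 _ neg0) (h40 _ pos0) pos0 (mh4 _ mneg) (mh4 _ mpos) mpos key.
have := @integral_add_density _ _ _ (mu (x + A x)) (mu (x - A x)) (mu x)
  _ _ _ (h40 _ neg0) (h40 _ pos0) neg0 (mh4 _ mneg) (mh4 _ mpos) mneg key.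
rewrite !int42 // !int0 //; last by move=> l; rewrite mulrC posneg0.
rewrite !adde0 sqrE.
rewrite -(fineK fp2) -(fineK fn2) -(fineK (fin_pos dp)) -(fineK (fin_pos dm)).
rewrite -(fineK (fin_neg dp)) -(fineK (fin_neg dm)) -!EFinM -!EFinD => -[h1] [h2].
congr EFin; have := polarization dx dAx; rewrite -hnorm_sqr hnorm_selfadj.
rewrite !rdot_posneg // /Ip /In; lra.
Qed.

(** On [B] the second moment is at most [r^2] times the mass. This brings arbitrary vectors into the
    domain after cutting the spectrum. *)
Lemma dom_pvm_bounded B (r : R) x : measurable B -> (forall l, B l -> `|l| <= r) ->
  dom K (E B x).
Proof.
move=> mB Br; apply/dom_smass; rewrite integral_smass_pvm //; last by move=> l; rewrite sqr_ge0.
apply: (@le_lt_trans _ _ (\int[mu x]_(l in B) (r ^+ 2)%:E)%E).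
  apply: ge0_le_integral => //.
  - by move=> l _; rewrite lee_fin sqr_ge0.
  - by apply/measurable_EFinP/measurable_funTS; exact: measurable_sqr.
  - move=> l Bl; rewrite lee_fin -(real_normK (num_real l)).
    by rewrite ler_pXn2r ?nnegrE ?(le_trans _ (Br l Bl)) ?Br.
by rewrite integral_cst // [X in (_ * X)%E]smassE -EFinM ltry.
Qed.

(** * The resolvent norm as a spectral integral *)

Section Resolvent.
Variable c : R.
Hypothesis c0 : c != 0.
Local Notation res := (resolvent K c).
Local Notation g := (fun l : R => (l ^+ 2 + c ^+ 2)^-1).

Lemma resolvent_pvm B y : measurable B -> res (E B y) = E B (res y).
Proof.
move=> mB; have dx := dom_resolvent hK y c0.
have [dEx h] := pvm_app mB dx.
by rewrite -{1}(resolventK hK y c0) pvmD // pvmZ // -h shiftK.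
Qed.

Let w0 l : 0 < l ^+ 2 + c ^+ 2.
Proof. by rewrite ltr_wpDl ?sqr_ge0 // lt_def sqrf_eq0 c0 sqr_ge0. Qed.

Let mw : measurable_fun [set: R] (fun l => l ^+ 2 + c ^+ 2).
Proof. by apply: measurable_funD => //; exact: measurable_sqr. Qed.

Lemma weight_ge0 l : 0 <= g l.
Proof. by rewrite invr_ge0 ltW. Qed.

Lemma measurable_weight : measurable_fun [set: R] g.
Proof.
apply: continuous_measurable_fun => l; apply: cvgV; first by rewrite gt_eqF.
apply: cvgD; last exact: cvg_cst.
exact: exprn_continuous.
Qed.

(** With [x = res y], one has [|E_C y|^2 = |K (E_C x)|^2 + c^2 |E_C x|^2], so [mu y] has density
    [l^2 + c^2] with respect to [mu x] and the weight cancels it. Taking [y] in the domain puts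
    [K x] there too, as [integral_sqr_smass] demands. *)
Let resolvent_dom y : dom K y -> (\int[mu y]_l (g l)%:E = (hnorm (res y) ^+ 2)%:E)%E.
Proof.
move=> dy; set x := res y; have dx : dom K x by exact: dom_resolvent.
have Kx := app_resolvent hK y c0.
have dKx : dom K (K x).
  rewrite Kx; apply: csubspaceB => //; first exact: csa_dom.
  by apply: csubspaceZ => //; exact: csa_dom.
rewrite (integral_eq_density (nu := mu x) (h := fun l => l ^+ 2 + c ^+ 2)) //.
- under eq_integral do rewrite mulVf ?gt_eqF //.
  by rewrite integral_smass_cst mul1r.
- by move=> l; exact: ltW.
- exact: weight_ge0.
- exact: measurable_weight.
move=> C mC; have [dEx KEx] := pvm_app mC dx.
rewrite -integral_smass_pvm //; last by move=> l; exact: ltW.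
under eq_integral do rewrite EFinD.
rewrite ge0_integralD //; [ | by move=> l _; rewrite lee_fin sqr_ge0
  | by apply/measurable_EFinP; exact: measurable_sqr
  | by move=> l _; rewrite lee_fin sqr_ge0].
rewrite integral_smass_cst integral_sqr_smass //; last first.
  by rewrite KEx; have [] := pvm_app mC dKx.
by rewrite /= smassE -EFinD -hnorm_shift // KEx -(pvmZ pE) // -pvmD // resolventK.
Qed.

(** The domain restriction is removed by cutting the line into the bounded shells
    [k <= |l| < k + 1]: each [E (B k) y] lies in the domain, and countable additivity reassembles
    both sides. *)
Lemma resolvent_integral y :
  (\int[mu y]_l (g l)%:E = (hnorm (res y) ^+ 2)%:E)%E.
Proof.
pose B k := [set l : R | k%:R <= `|l| < k.+1%:R].
have mB k : measurable (B k).
  rewrite (_ : B k = (fun l : R => `|l|) @^-1` `[k%:R, k.+1%:R[%classic).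
    by rewrite -[X in measurable X]setTI; exact: normr_measurable.
  by apply/seteqP; split=> l; rewrite /B /= in_itv.
have tB : trivIset setT B.
  apply/trivIsetP => i j _ _; wlog ij : i j / (i < j)%N.
    by move=> h; rewrite neq_ltn => /orP[] lt; [|rewrite setIC]; apply: h => //; rewrite neq_ltn lt.
  move=> _; apply/seteqP; split=> // l [/andP[_ l1] /andP[l2 _]].
  have := le_lt_trans l2 l1; rewrite ltr_nat ltnS leqNgt ij //.
have uB : \bigcup_k B k = setT.
  apply/seteqP; split=> // l _; exists (Num.truncn `|l|) => //.
  by rewrite /B /= truncn_itv.
have cell k : (\int[mu y]_(l in B k) (g l)%:E = mu (res y) (B k))%E.
  rewrite -integral_smass_pvm //; last 2 first.
  - exact: weight_ge0.
  - exact: measurable_weight.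
  rewrite resolvent_dom; last first.
    by apply: (@dom_pvm_bounded _ k.+1%:R) => // l /andP[_ /ltW].
  by rewrite resolvent_pvm.
rewrite -uB ge0_integral_bigcup //; last 2 first.
- by rewrite uB; apply/measurable_EFinP; exact: measurable_weight.
- by move=> l _; rewrite lee_fin weight_ge0.
rewrite -(smassT pE (res y)) -uB measure_semi_bigcup //; last by rewrite uB.
by apply: eq_eseriesr => k _; exact: cell.
Qed.

End Resolvent.

End SpectralMeasure.

(** * Suprema and the multiscale operator *)

Section NonnegSup.
Context {R : realType}.
Implicit Types (A B : set (\bar R)) (x y : \bar R).
Local Open Scope ereal_scope.

Lemma nonneg_sup_ge0 A : 0 <= nonneg_sup A.
Proof. by rewrite /nonneg_sup le_max lexx. Qed.

Lemma nonneg_sup_ubound A x : A x -> x <= nonneg_sup A.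
Proof. by move=> Ax; rewrite /nonneg_sup le_max ereal_sup_ubound ?orbT. Qed.

Lemma nonneg_sup_le A y : 0 <= y -> (forall x, A x -> x <= y) -> nonneg_sup A <= y.
Proof. by move=> y0 h; rewrite /nonneg_sup ge_max y0 ge_ereal_sup. Qed.

(** Here [B] plays the unit ball and [S] the unit sphere. The alternative [n u = 0] covers the zero
    vector, in particular the trivial space, where [S] is empty and [nonneg_sup] takes the value
    0. *)
Lemma sqr_ereal_sup (U : Type) (B S : set U) (n : U -> R) :
  (forall u, 0 <= n u)%R -> B !=set0 -> S `<=` B ->
  (forall u, B u -> n u = 0%R \/ exists2 v, S v & (n u <= n v)%R) ->
  ereal_sup [set (n u)%:E | u in B] ^+ 2 = nonneg_sup [set ((n u) ^+ 2)%:E | u in S].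
Proof.
move=> n0 [u0 Bu0] SB BS; set s := ereal_sup _; set t := nonneg_sup _.
have s0 : 0 <= s.
  by apply: (@le_trans _ _ (n u0)%:E); [rewrite lee_fin|apply: ereal_sup_ubound; exists u0].
have t0 : 0 <= t := nonneg_sup_ge0 _.
have leT : t <= s ^+ 2.
  apply: nonneg_sup_le; first exact: expe_ge0.
  move=> _ [u Su <-]; have : (n u)%:E <= s by apply: ereal_sup_ubound; exists u => //; exact: SB.
  case: s s0 => [s| |] // s0; rewrite ?lee_fin => h; last by rewrite expe2 mulyy leey.
  by rewrite -expr2 ler_pXn2r ?nnegrE.
apply/eqP; rewrite eq_le leT andbT.
case tE : t t0 => [r| |] // r0; last by rewrite leey.
have : s <= (Num.sqrt r)%:E.
  apply: ge_ereal_sup => _ [u Bu <-]; rewrite lee_fin.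
  have [->|[v Sv uv]] := BS u Bu; first exact: sqrtr_ge0.
  apply: le_trans uv _; rewrite -(ger0_norm (n0 v)) -sqrtr_sqr ler_wsqrtr //.
  by rewrite -lee_fin -tE; apply: nonneg_sup_ubound; exists v.
case: s s0 leT => [s| |] // s0 _; rewrite lee_fin => h.
rewrite lee_fin -[leRHS]sqr_sqrtr; last by rewrite -lee_fin.
by rewrite -expr2 ler_pXn2r ?nnegrE // sqrtr_ge0.
Qed.

(** Where [|l| >= lambda0] the weight is at most [lambda0^-2], so the tail contributes at most
    [lambda0^-2 * k], whatever [eps] and [u] are. *)
Lemma nonneg_sup_weight_split (U : Type) (A : set U)
    (m : U -> {measure set R -> \bar R}) (k delta lambda0 : R) :
  (0 <= k)%R -> (0 < delta)%R -> (0 < lambda0)%R ->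
  (forall u, A u -> m u setT <= k%:E) ->
  let low := [set l : R | `|l| < lambda0]%R in
  let II eps D := nonneg_sup [set weighted_integral (m u) (delta * eps) D | u in A] in
  exists2 r : R -> R, bounded_near r (0 : R)^'+ &
    forall eps : R, (0 < eps)%R -> II eps setT = II eps low + (r eps)%:E.
Proof.
move=> k0 d0 l0 mk low II.
pose r eps := (fine (II eps setT) - fine (II eps low))%R.
have mlow : measurable low.
  rewrite (_ : low = (@Num.norm R R) @^-1` `]-oo, lambda0[%classic).
    by rewrite -[X in measurable X]setTI; exact: normr_measurable.
  by apply/seteqP; split=> l; rewrite /low /= in_itv.
have key eps : (0 < eps)%R -> [/\ II eps setT \is a fin_num, II eps low \is a fin_num,
    II eps low <= II eps setT & II eps setT <= II eps low + (lambda0 ^- 2 * k)%:E].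
  move=> e0; set c := (delta * eps)%R; have c0 : (0 < c)%R by exact: mulr_gt0.
  pose g (l : R) := (l ^+ 2 + c ^+ 2)^-1%R.
  have g0 l : (0 <= g l)%R by apply: weight_ge0; rewrite gt_eqF.
  have mg D : measurable_fun D (fun l => (g l)%:E).
    apply/measurable_EFinP/measurable_funTS.
    by apply: measurable_weight; rewrite gt_eqF.
  have c2 : (0 < c ^+ 2)%R by rewrite exprn_gt0.
  have wle u D (b : R) : A u -> measurable D -> (0 <= b)%R ->
      (forall l, D l -> g l <= b)%R ->
      weighted_integral (m u) c D <= (b * k)%:E.
    move=> Au mD b0 gb.
    apply: (@le_trans _ _ (\int[m u]_(l in D) b%:E)).
      apply: ge0_le_integral => //.
      by move=> l _; rewrite lee_fin; exact: g0.
    rewrite integral_cst // EFinM lee_wpmul2l ?lee_fin //.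
    by apply: le_trans (mk u Au); rewrite le_measure ?inE.
  have low_le u : weighted_integral (m u) c low <= weighted_integral (m u) c setT.
    by apply: ge0_subset_integral => // l _; rewrite lee_fin; exact: g0.
  have lo : II eps low <= II eps setT.
    apply: nonneg_sup_le; first exact: nonneg_sup_ge0.
    move=> _ [u Au <-]; apply: le_trans (low_le u) _.
    by apply: nonneg_sup_ubound; exists u.
  (* The bound [c^-2 * k] blows up as [eps] tends to 0, but it only serves to make the difference of
     the two suprema meaningful. *)
  have fT : II eps setT \is a fin_num.
    rewrite ge0_fin_numE ?nonneg_sup_ge0 //.
    apply: (@le_lt_trans _ _ ((c ^+ 2)^-1 * k)%:E); last by rewrite ltry.
    apply: nonneg_sup_le.
      by rewrite lee_fin mulr_ge0 // invr_ge0 ltW.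
    move=> _ [u Au <-]; apply: wle => //; first by rewrite invr_ge0 ltW.
    by move=> l _; rewrite /g lef_pV2 ?posrE ?lerDr ?sqr_ge0 // ltr_wpDl ?sqr_ge0.
  split=> //.
    by rewrite ge0_fin_numE ?nonneg_sup_ge0 //; apply: le_lt_trans lo _; rewrite ltey_eq fT.
  have l2 : (0 <= lambda0 ^- 2 * k)%R by rewrite mulr_ge0 // invr_ge0 ltW // exprn_gt0.
  apply: nonneg_sup_le; first by rewrite adde_ge0 ?nonneg_sup_ge0 // lee_fin.
  move=> _ [u Au <-]; rewrite /weighted_integral -(setUv low) ge0_integral_setU //.
  - apply: leeD; first by apply: nonneg_sup_ubound; exists u.
    apply: wle => //; first exact: measurableC.
      by rewrite invr_ge0 ltW // exprn_gt0.
    move=> l; rewrite /low /= => /negP; rewrite -leNgt => ll.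
    rewrite /g lef_pV2 ?posrE ?exprn_gt0 // ?ltr_wpDl ?sqr_ge0 //.
    rewrite (@le_trans _ _ (l ^+ 2)%R) ?lerDl ?sqr_ge0 //.
    by rewrite -(real_normK (num_real l)) ler_pXn2r ?nnegrE // ltW.
  - exact: measurableC.
  - by move=> l _; rewrite lee_fin; exact: g0.
  - by apply/disj_setPRL.
exists r.
  apply/ex_bound; exists (lambda0 ^- 2 * k)%R; near=> eps.
  have /key [f1 f2 lo up] : (0 < eps)%R by near: eps; exact: nbhs_right_gt.
  move: lo up; rewrite -(fineK f1) -(fineK f2) -EFinD !lee_fin => lo up.
  by rewrite /= /r ger0_norm ?subr_ge0 // lerBlDl.
move=> eps /key [f1 f2 _ _]; rewrite -(fineK f2) -EFinD /r subrKC fineK //.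
Unshelve. all: by end_near. Qed.

End NonnegSup.

(** * Homogeneity of the corrector and of [VbarPi0] *)

Section Homogeneity.
Context {R : realType} {H : hilbertType R}.
Variables (Jmacro Jmicro : operator H) (M : {linear H -> H}) (Mbox mbox alpha : R).
Hypotheses (hmacro : closed_skew_adjoint Jmacro) (hmicro : closed_skew_adjoint Jmicro).
Hypotheses (hM : material_coefficients M Mbox mbox) (halpha : 0 < alpha).
Implicit Types (u v x y : H) (c : R[i]).

Local Notation P0 := (P0 Jmicro).
Local Notation Pi0 := (Pi0 Jmacro Jmicro).
Local Notation Pf := (Pifluct Jmacro Jmicro).
Local Notation Kmicro := (Kmicro Jmacro Jmicro M alpha).
Local Notation fluct_inv := (fluct_inv Jmacro Jmicro M alpha).

Let ker_sub := (csa_ker hmicro).1.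
Let ker_closed := (csa_ker hmicro).2.

Let P0_linear c u v : P0 (c *: u + v) = c *: P0 u + P0 v.
Proof. exact: orth_proj_linear. Qed.

Let range_sub : csubspace [set u | [/\ range P0 u, dom Jmacro u & range P0 (Jmacro u)]].
Proof.
have r0 : range P0 0.
  by exists 0 => //; apply: orth_proj_id => //; exact: ker_sub.1.
have rL c u v : range P0 u -> range P0 v -> range P0 (c *: u + v).
  by move=> [a _ <-] [b _ <-]; exists (c *: a + b) => //; rewrite P0_linear.
split; first by split=> //; [exact: (csa_dom hmacro).1|rewrite (csa0 hmacro)].
move=> c u v [ru du rJu] [rv dv rJv]; split; first exact: rL.
  exact: (csa_dom hmacro).2.
by rewrite (csaL hmacro) //; exact: rL.
Qed.

Let macro_sub := csubspace_hclosure range_sub.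
Let macro_closed := @hclosure_closed _ _
  [set u | [/\ range P0 u, dom Jmacro u & range P0 (Jmacro u)]].

Let Pi0_linear c u v : Pi0 (c *: u + v) = c *: Pi0 u + Pi0 v.
Proof. exact: orth_proj_linear. Qed.

Let Pf_linear c u v : Pf (c *: u + v) = c *: Pf u + Pf v.
Proof. by rewrite /Pifluct P0_linear Pi0_linear scalerBr opprD addrACA. Qed.

Let Pf_rdot u v : rdot (Pf u) v = rdot u (Pf v).
Proof.
by rewrite /Pifluct /rdot hdotBl hdotBr !orth_proj_adjoint.
Qed.

Let linear0 (f : H -> H) : (forall c u v, f (c *: u + v) = c *: f u + f v) -> f 0 = 0.
Proof. by move=> fL; apply: (addrI (f 0)); rewrite -{1}[f 0]scale1r -fL scaler0 !addr0. Qed.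

Let linearZ0 (f : H -> H) : (forall c u v, f (c *: u + v) = c *: f u + f v) ->
  forall c u, f (c *: u) = c *: f u.
Proof. by move=> fL c u; rewrite -[_ *: u]addr0 fL linear0 // addr0. Qed.

Let M_linear c u v : M (c *: u + v) = c *: M u + M v.
Proof. exact: linearP. Qed.

Let fluct x := Pf (M (Pf x)) + alpha%:C *: x.

Let fluct_linear c u v : fluct (c *: u + v) = c *: fluct u + fluct v.
Proof.
by rewrite /fluct Pf_linear M_linear Pf_linear !scalerDr addrACA !scalerA [_ * c]mulrC.
Qed.

(** Pairing [fluct z = 0] with [z = x - y] gives [alpha |z|^2 + Re <M (Pf z), Pf z> = 0]; the second
    term is nonnegative and [alpha] is positive. *)
Let fluct_inj : injective fluct.
Proof.
move=> x y /eqP; rewrite -subr_eq0 => /eqP h.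
have {}h : fluct (x - y) = 0.
  by rewrite addrC -scaleN1r fluct_linear scaleN1r addrC.
have [_ m0 _ mM] := hM.
have := congr1 (fun z => rdot z (x - y)) h.
rewrite rdot0l /fluct rdotDl rdotZl Pf_rdot.
have := mM (Pf (x - y)); rewrite -/(rdot _ _) -hnorm_sqr => h1 h2.
apply/eqP; rewrite -subr_eq0 -hnorm_eq0 -sqrf_eq0.
have h3 : 0 <= mbox * hnorm (Pf (x - y)) ^+ 2 by rewrite mulr_ge0 ?sqr_ge0.
have h4 := sqr_ge0 (hnorm (x - y)).
have : alpha * hnorm (x - y) ^+ 2 <= 0 by lra.
by rewrite pmulr_rle0 // => h5; rewrite eq_le h5 h4.
Qed.

(** If [y] has a preimage, injectivity makes it unique and it scales with [c]. Otherwise [c *: y]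
    has none either, since [c] is invertible, and both sides are the default value 0. *)
Let fluct_invZ c y : c != 0 -> fluct_inv (c *: y) = c *: fluct_inv y.
Proof.
move=> c0; rewrite /fluct_inv /inv_fun /inv_op /=.
have [[x xy]|h] := pselect (exists x, fluct x = y).
  have inv z t : fluct z = t -> xget 0 [set x0 | setT x0 /\ fluct x0 = t] = z.
    move=> zt; apply: fluct_inj; rewrite zt.
    by have [] := @xgetPex _ 0 [set x0 | setT x0 /\ fluct x0 = t] (ex_intro _ z (conj I zt)).
  rewrite (inv x y) // (inv (c *: x) (c *: y)) //.
  by rewrite (linearZ0 fluct_linear) xy.
rewrite !xgetPN ?scaler0 // => x [_ xy]; apply: h; first by exists x.
exists (c^-1 *: x); rewrite (linearZ0 fluct_linear).
by rewrite [fluct x]xy scalerA mulVf // scale1r.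
Qed.

(** The hypothesis [dV] puts [Kmicro (Pi0 u)] in the domain of [Jmacro], outside of which the values
    of [Jmacro] are arbitrary. *)
Lemma VbarPi0Z c u : c != 0 -> dom (Vbar Jmacro Jmicro M alpha) (Pi0 u) ->
  VbarPi0 Jmacro Jmicro M alpha (c *: u) = c *: VbarPi0 Jmacro Jmicro M alpha u.
Proof.
move=> c0 dV; have PiZ := linearZ0 Pi0_linear c; have PfZ := linearZ0 Pf_linear c.
have MZ := linearZ0 M_linear c.
have KZ v : Kmicro (c *: v) = c *: Kmicro v.
  by rewrite /Kmicro PiZ MZ PfZ fluct_invZ // PfZ scalerN.
rewrite /VbarPi0 /Vbar /= PiZ KZ -scalerDr MZ (csaZ hmacro) //.
have -> : M0 Jmacro Jmicro M alpha (c *: Pi0 u) = c *: M0 Jmacro Jmicro M alpha (Pi0 u).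
  rewrite /M0 PiZ MZ PfZ fluct_invZ // PfZ MZ PiZ.
  by rewrite PiZ scalerBr.
by rewrite !scalerBr !scalerA [_ * c]mulrC.
Qed.

End Homogeneity.

(** * The dual of the graph space *)

Section Dual.
Context {R : realType} {H : hilbertType R} (J : operator H).
Hypothesis hJ : closed_skew_adjoint J.
Implicit Types (u v w x y g h : H) (phi psi : H -> R[i]) (c : R[i]).

(* [v |-> v - J v] is an isometry of [dom J], with its graph norm, onto [H]; it
   transports Riesz representations from [H] to the dual of [dom J]. *)
Definition dual_repr phi g := forall v, dom J v -> phi v = hdot H g (v - J v).

Lemma graph_normE v : dom J v -> graph_norm J v = hnorm (v - J v).
Proof.
move=> dv; apply/eqP; rewrite -(@eqrXn2 _ 2) ?sqrtr_ge0 //.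
rewrite /graph_norm sqr_sqrtr ?addr_ge0 ?sqr_ge0 // hnormBC.
have := hnorm_shift hJ (-1) dv; rewrite rmorphN1 scaleN1r => ->.
by rewrite sqrrN expr1n mul1r addrC.
Qed.

Lemma graph_norm0 : graph_norm J 0 = 0.
Proof. by rewrite /graph_norm (csa0 hJ) hnorm0 expr0n addr0 sqrtr0. Qed.

Lemma graph_norm_ge0 v : 0 <= graph_norm J v.
Proof. exact: sqrtr_ge0. Qed.

Lemma graph_norm_eq0 v : dom J v -> graph_norm J v = 0 -> v = 0.
Proof.
move=> dv /eqP; rewrite sqrtr_eq0 => h; apply/eqP; rewrite -hnorm_eq0 -sqrf_eq0.
by have := sqr_ge0 (hnorm v); have := sqr_ge0 (hnorm (J v)); move=> h1 h2; apply/eqP; lra.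
Qed.

Lemma graph_normZ c v : dom J v -> graph_norm J (c *: v) = complex.Re `|c| * graph_norm J v.
Proof.
move=> dv; rewrite !graph_normE //; last by apply: csubspaceZ => //; exact: csa_dom.
by rewrite csaZ // -scalerBr hnormZ.
Qed.

Let N1 : -1 != 0 :> R. Proof. by rewrite oppr_eq0 oner_eq0. Qed.

(** The inverse of [v |-> v - J v]: [resolvent J (-1)] inverts [J - 1], hence the sign. *)
Let Q y := - resolvent J (-1) y.

Let dom_Q y : dom J (Q y).
Proof.
rewrite /Q -scaleN1r; apply: csubspaceZ; first exact: csa_dom.
exact: dom_resolvent.
Qed.

Let QK y : Q y - J (Q y) = y.
Proof.
have dr := dom_resolvent hJ y N1; rewrite /Q csaN // opprK addrC.
by have := resolventK hJ y N1; rewrite rmorphN1 scaleN1r.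
Qed.

Let graph_norm_Q y : graph_norm J (Q y) = hnorm y.
Proof. by rewrite graph_normE // QK. Qed.

Let Q_linear c x y : Q (c *: x + y) = c *: Q x + Q y.
Proof. by rewrite /Q (resolvent_linear hJ) // opprD scalerN. Qed.

(** Cauchy-Schwarz and the isometry give one inequality; for [g] nonzero the supremum is attained at
    [Q] of the normalized vector [g / |g|]. *)
Lemma dual_repr_norm phi g : dual_repr phi g -> dual_norm J phi = (hnorm g)%:E.
Proof.
move=> pg; apply/eqP; rewrite eq_le; apply/andP; split.
  apply: ge_ereal_sup => _ [v [dv v1] <-]; rewrite lee_fin pg //.
  apply: le_trans (Re_norm_hdot _ _) _; rewrite -graph_normE //.
  by rewrite ler_piMr.
have [->|g0] := eqVneq g 0.
  rewrite hnorm0; apply: (@le_trans _ _ (complex.Re `|phi 0|)%:E).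
    by rewrite lee_fin normc_def sqrtr_ge0.
  apply: ereal_sup_ubound; exists 0 => //; split; first exact: (csa_dom hJ).1.
  by rewrite /= graph_norm0.
have gp : 0 < hnorm g by rewrite lt_def hnorm_eq0 g0 /=.
pose y := ((hnorm g)^-1)%:C *: g.
have y1 : hnorm y = 1 by rewrite hnormZr ger0_norm ?invr_ge0 // mulVf // gt_eqF.
apply: ereal_sup_ubound; exists (Q y); first by split=> //; rewrite /= graph_norm_Q y1.
rewrite pg // QK /y hdotZr real_complex_conj hdot_self -rmorphM -hnorm_sqr expr2 mulKf ?gt_eqF //.
by rewrite normc_def /= expr0n addr0 sqrtr_sqr ger0_norm.
Qed.

Lemma dual_repr_space phi g : dual_repr phi g -> dual_space J phi.
Proof.
move=> pg; split; last by rewrite (dual_repr_norm pg) ltry.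
move=> c u v du dv; rewrite !pg //; last exact: (csa_dom hJ).2.
have -> : c *: u + v - J (c *: u + v) = c *: (u - J u) + (v - J v).
  by rewrite (csaL hJ) // opprD addrACA scalerBr.
by rewrite [LHS]hdotDr [X in X + _]hdotZr.
Qed.

(** Composition with the isometry [Q] turns [phi] into a bounded functional on all of [H], to which
    [riesz] applies. *)
Lemma dual_repr_exists phi : dual_space J phi -> exists g, dual_repr phi g.
Proof.
move=> [pL pb].
have d0 := (csa_dom hJ).1.
have p0 : phi 0 = 0.
  apply: (addrI (phi 0)); rewrite addr0; have := pL 1 0 0 d0 d0.
  by rewrite scale1r addr0 rmorph1 mul1r => <-.
have pZ c v : dom J v -> phi (c *: v) = c^* * phi v.
  by move=> dv; rewrite -[_ *: v]addr0 pL // p0 addr0.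
have bnd v : dom J v -> graph_norm J v <= 1 -> ((complex.Re `|phi v|)%:E <= dual_norm J phi)%E.
  by move=> dv v1; apply: ereal_sup_ubound; exists v.
have fin : dual_norm J phi \is a fin_num.
  rewrite ge0_fin_numE //; apply: le_trans (bnd 0 d0 _).
    by rewrite lee_fin normc_def sqrtr_ge0.
  by rewrite graph_norm0.
have [g gP] : exists g, forall y, phi (Q y) = hdot H g y.
  apply: (@riesz _ _ (phi \o Q) (fine (dual_norm J phi))).
    by move=> c x y /=; rewrite Q_linear pL.
  move=> y; rewrite [(phi \o Q) y]/=; have [->|y0] := eqVneq y 0.
    have -> : Q 0 = 0.
      by apply: (addrI (Q 0)); rewrite -{1}[Q 0]scale1r -Q_linear scaler0 !addr0.
    by rewrite p0 hnorm0 mulr0 normr0.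
  have yp : 0 < hnorm y by rewrite lt_def hnorm_eq0 y0 /=.
  have dZ : dom J (((hnorm y)^-1)%:C *: Q y) by apply: csubspaceZ => //; exact: csa_dom.
  have := bnd _ dZ; rewrite graph_normZ // graph_norm_Q Re_norm_real.
  rewrite ger0_norm ?invr_ge0 // mulVf ?gt_eqF // => /(_ (lexx _)).
  rewrite -[X in (_ <= X)%E]fineK // lee_fin pZ // real_complex_conj normrM.
  have -> : `|((hnorm y)^-1)%:C| = ((hnorm y)^-1)%:C.
    by rewrite -[LHS]RRe_real ?normr_real // Re_norm_real ger0_norm ?invr_ge0.
  by rewrite ReZ mulrC ler_pdivrMr.
exists g => v dv; rewrite -gP; congr phi; apply/esym.
rewrite /Q; apply/eqP; rewrite eqr_oppLR; apply/eqP.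
have := shiftK hJ N1 (x := - v).
by rewrite rmorphN1 scaleN1r opprK csaN ?[- _ + _]addrC; first apply;
   rewrite // -scaleN1r; apply: csubspaceZ => //; exact: csa_dom.
Qed.

Lemma dual_repr_unique phi g h : dual_repr phi g -> dual_repr phi h -> g = h.
Proof.
move=> pg ph; apply/eqP; rewrite -subr_eq0; apply/eqP/rdot_eq0P => y.
by rewrite /rdot hdotBl -(QK y) -pg // -ph // subrr.
Qed.

Lemma dual_repr_linear c phi psi g h : dual_repr phi g -> dual_repr psi h ->
  dual_repr (fun v => c * phi v + psi v) (c *: g + h).
Proof. by move=> pg ph v dv; rewrite pg // ph // hdotDl hdotZl. Qed.

Lemma dual_repr_eq phi psi g : dual_eq J phi psi -> dual_repr psi g -> dual_repr phi g.
Proof. by move=> e pg v dv; rewrite e // pg. Qed.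

(** Skew-symmetry moves [J] across the product. Thus the representative of an embedded vector [h] is
    [resolvent J 1 h]. *)
Lemma dual_repr_shift g : dom J g -> dual_repr (embed (g + J g)) g.
Proof.
by move=> dg v dv; rewrite /embed hdotDl hdotBr csa_skewC.
Qed.

(** * Extension to the dual of operators commuting with [J] *)

Section Extension.
Variables (T : H -> H) (k : R).
Hypotheses (TL : forall c u v, T (c *: u + v) = c *: T u + T v)
  (Tk : forall u, hnorm (T u) <= k * hnorm u)
  (TJ : forall u, dom J u -> dom J (T u) /\ J (T u) = T (J u)).

Let T_shift g : dom J g -> T (g + J g) = T g + J (T g).
Proof. by move=> dg; rewrite -[X in T (X + _)]scale1r TL scale1r (TJ dg).2. Qed.

(** For [x] in [dom J], commutation of [T] with [J] shows that [T'] sends the functional represented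
    by [x] to the one represented by [T x]. Density of [dom J] and boundedness of [T] and [T']
    extend this to every [g]. *)
Lemma is_dual_extension_repr T' phi g : is_dual_extension J T T' ->
  dual_repr phi g -> dual_repr (T' phi) (T g).
Proof.
move=> [T'S T'L [C T'C] T'e] pg.
have [g' pg'] := dual_repr_exists (T'S _ (dual_repr_space pg)).
suff -> : T g = g' by [].
apply/eqP; rewrite -subr_eq0 -hnorm_eq0 eq_le hnorm_ge0 andbT.
apply/ler_addgt0Pl => e e0; rewrite addr0.
(* The error has one part from [T], with constant [k], and one from [T'], with constant [C]; the
   added 1 keeps the divisor positive. *)
have D0 : 0 < `|k| + `|C| + 1 by have := normr_ge0 k; have := normr_ge0 C; lra.
have : hclosure (dom J) g by rewrite (csa_dense hJ).
move=> /(_ _ (divr_gt0 e0 D0)) [x dx gx].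
have px := dual_repr_shift dx; set h := x + J x in px.
have pTx : dual_repr (T' (embed h)) (T x).
  apply: dual_repr_eq (T'e h) _; rewrite /h T_shift //.
  exact: dual_repr_shift (TJ dx).1.
have pd := dual_repr_linear (-1) px pg.
have pTd := dual_repr_eq (T'L (-1) _ _ (dual_repr_space px) (dual_repr_space pg))
  (dual_repr_linear (-1) pTx pg').
have := T'C _ (dual_repr_space pd).
rewrite (dual_repr_norm pd) (dual_repr_norm pTd) -EFinM lee_fin !scaleN1r => h1.
have -> : T g - g' = T (g - x) - (- T x + g').
  have -> : T (g - x) = T g - T x by rewrite addrC -scaleN1r TL scaleN1r addrC.
  by rewrite opprD opprK addrA subrK.
apply: le_trans (ler_hnormD _ _) _; rewrite hnorm_opp.
have h2 : C * hnorm (- x + g) <= `|C| * hnorm (g - x).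
  by rewrite [- x + g]addrC ler_wpM2r // ler_norm.
have h3 : k * hnorm (g - x) <= `|k| * hnorm (g - x) by rewrite ler_wpM2r // ler_norm.
have h4 := Tk (g - x); rewrite ltr_pdivlMr // in gx.
have := hnorm_ge0 (g - x); nra.
Qed.

(** Apply [T] to the representing vector. To see that this extends [T], write [h = x + J x] and use
    that [T] commutes with [J]. *)
Lemma is_dual_extension_exists : exists T', is_dual_extension J T T'.
Proof.
pose G phi := xget 0 [set g | dual_repr phi g].
have GP phi g : dual_repr phi g -> G phi = g.
  move=> pg; apply: (@dual_repr_unique phi) => //.
  exact: (@xgetPex _ 0 [set g | dual_repr phi g] (ex_intro _ g pg)).
pose T' phi v := hdot H (T (G phi)) (v - J v).
have T'P phi g : dual_repr phi g -> dual_repr (T' phi) (T g).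
  by move=> pg v dv; rewrite /T' (GP _ _ pg).
exists T'; split.
- by move=> phi /dual_repr_exists [g pg]; exact: dual_repr_space (T'P _ _ pg).
- move=> c phi psi /dual_repr_exists [g pg] /dual_repr_exists [h ph] v dv.
  rewrite (T'P _ _ (dual_repr_linear c pg ph)) // (T'P _ _ pg) // (T'P _ _ ph) //.
  by rewrite TL hdotDl hdotZl.
- exists k => phi /dual_repr_exists [g pg].
  by rewrite (dual_repr_norm pg) (dual_repr_norm (T'P _ _ pg)) -EFinM lee_fin.
- move=> h v dv; have [dx ex] := resolventP hJ h (oner_neq0 R).
  set x := resolvent J 1 h in dx ex.
  have {}ex : h = x + J x by rewrite -[LHS]ex scale1r addrC.
  rewrite {1}ex (T'P _ _ (dual_repr_shift dx)) // ex T_shift //.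
  by rewrite (dual_repr_shift (TJ dx).1).
Qed.

Lemma dual_extension_repr phi g :
  dual_repr phi g -> dual_repr (dual_extension J T phi) (T g).
Proof.
apply: is_dual_extension_repr; have [T' hT'] := is_dual_extension_exists.
by rewrite /dual_extension; case: xgetP => [T'' _ //|/(_ T') /(_ hT')].
Qed.

End Extension.

End Dual.

(** * Resolvent estimates *)

Section SetFunction.
Import HBNNSimple.

(** [dual_spectral_mass] is a bare set function without measure structure, so the integral is
    unfolded: it evaluates the set function only on measurable level sets of simple functions. *)
Lemma eq_set_function_integral d (T : measurableType d) (R : realType)
    (m1 m2 : set T -> \bar R) (D : set T) (f : T -> \bar R) :
  (forall A, measurable A -> m1 A = m2 A) ->
  (\int[m1]_(x in D) f x = \int[m2]_(x in D) f x)%E.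
Proof.
move=> m12; rewrite /integral.
by congr (ereal_sup _ - ereal_sup _)%E; apply: eq_imagel => h _;
   apply: eq_fsbigr => r _; rewrite m12.
Qed.

End SetFunction.

(** Dividing [u] by [N u <= 1] lands on the unit sphere of [N] and can only increase [n]. This
    supplies the ball-to-sphere hypothesis of [sqr_ereal_sup]. *)
Lemma homogeneous_le (R : realType) (H : hilbertType R) (D : set H) (N n : H -> R) :
  (forall t u, D u -> D (t *: u)) ->
  (forall u, D u -> 0 <= N u) -> (forall u, 0 <= n u) ->
  (forall t u, 0 < t -> D u -> N (t%:C *: u) = t * N u) ->
  (forall t u, 0 < t -> D u -> n (t%:C *: u) = t * n u) ->
  (forall u, D u -> N u = 0 -> n u = 0) ->
  forall u, D u -> N u <= 1 -> 
  n u = 0 \/ exists2 v, D v /\ N v = 1 & n u <= n v.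
Proof.
move=> DZ N0 n0 NZ nZ Nn u Du u1; have [/Nn|u0] := eqVneq (N u) 0; first by left; auto.
have Np : 0 < N u by rewrite lt_def u0 N0.
right; exists (((N u)^-1)%:C *: u).
  by split; [exact: DZ|rewrite NZ ?invr_gt0 // mulVf].
by rewrite nZ ?invr_gt0 // ler_peMl // invf_ge1.
Qed.

Lemma resolvent_commute (R : realType) (H : hilbertType R) (K : operator H)
    (T : H -> H) (t : R) :
  closed_skew_adjoint K -> t != 0 ->
  (forall c u v, T (c *: u + v) = c *: T u + T v) ->
  (forall u, dom K u -> dom K (T u) /\ K (T u) = T (K u)) ->
  forall y, resolvent K t (T y) = T (resolvent K t y).
Proof.
move=> hK t0 TL TK y; have [dx ex] := resolventP hK y t0.
have [dT KT] := TK _ dx; rewrite -{1}ex [_ + _]addrC TL -KT addrC.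
exact: shiftK.
Qed.

Theorem proposition2p18 (R : realType) (H : hilbertType R)
    (J Jmacro Jmicro : operator H) (S : R -> {linear H -> H})
    (M : {linear H -> H}) (Mbox mbox alpha delta : R)
    (E : set R -> H -> H)
    (hJ : closed_skew_adjoint J)
    (hS : scaling_structure J S Jmacro Jmicro)
    (hM : material_coefficients M Mbox mbox)
    (halpha : 0 < alpha) (hdelta : 0 < delta)
    (hV : VbarPi0_bounded_VH Jmacro Jmicro M alpha J)
    (hE : spectral_measure_of (scale_op (- 'i%C) Jmicro) E) :
  let low (lambda0 : R) := [set l : R | `|l| < lambda0] in
  let V := VbarPi0 Jmacro Jmicro M alpha in
  let II (eps : R) := sup_VH Jmacro Jmicro M alpha J E (delta * eps) in
  [/\ forall eps : R, 0 < eps ->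
        (opnorm_VH J (fun u => resolvent Jmicro (delta * eps)%R (V u)) ^+ 2
         = II eps [set: R])%E,
      forall lambda0 : R, 0 < lambda0 ->
        exists2 r : R -> R, bounded_near r (0 : R)^'+ &
          forall eps : R, 0 < eps ->
            II eps [set: R]
            = (II eps (low lambda0) + (r eps)%:E)%E
    & forall (F : set R -> H -> H) (W : H -> H -> R[i]),
        spectral_measure_of (scale_op (- 'i%C) J) F ->
        pvm_commute F E ->
        bounded_extension_HVdual J V W ->
        let IIdual (eps : R) := sup_HVdual J E W (delta * eps) in
        (forall eps : R, 0 < eps ->
           (opnorm_HVdual J (fun f =>
              dual_extension J (resolvent Jmicro (delta * eps)) (W f)) ^+ 2
            = IIdual eps [set: R])%E) /\
        (forall lambda0 : R, 0 < lambda0 ->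
           exists2 r : R -> R, bounded_near r (0 : R)^'+ &
             forall eps : R, 0 < eps ->
               IIdual eps [set: R]
               = (IIdual eps (low lambda0) + (r eps)%:E)%E)].
Proof.
move=> low V II.
have hmicro := scaling_micro hS; have hmacro := scaling_macro hS.
have pE : projection_valued_measure E by case: hE.
have [dV bV] := hV.
have dJ0 := (csa_dom hJ).1.
have dJZ (t : R[i]) u : dom J u -> dom J (t *: u) by apply: csubspaceZ; exact: csa_dom.
have VZ (t : R) u : t != 0 -> dom J u -> V (t%:C *: u) = t%:C *: V u.
  move=> t0 du; apply: (VbarPi0Z hmacro hmicro hM halpha); last exact: dV.
  by rewrite -(inj_eq (@complexI R)) in t0.
(* [VZ] covers nonzero scalars only, so the value at 0 comes from [V 0 = V (2 0) = 2 V 0]. *)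
have V0 : V 0 = 0.
  have n2 : 2 != 0 :> R by rewrite pnatr_eq0.
  have := congr1 (@hnorm _ H) (VZ 2 0 n2 dJ0).
  rewrite scaler0 hnormZr ger0_norm // => h.
  by apply/eqP; rewrite -hnorm_eq0; apply/eqP; lra.
have cpos eps : 0 < eps -> delta * eps != 0 by move=> e0; rewrite gt_eqF // mulr_gt0.
have res_int eps y : 0 < eps ->
    weighted_integral (smass pE y) (delta * eps) setT =
    (hnorm (resolvent Jmicro (delta * eps) y) ^+ 2)%:E.
  by move=> e0; apply: (resolvent_integral hmicro hE); exact: cpos.
have res0 eps : 0 < eps -> resolvent Jmicro (delta * eps) 0 = 0.
  move=> e0; apply/eqP; rewrite -hnorm_eq0 eq_le hnorm_ge0 andbT.
  by have := hnorm_resolvent hmicro 0 (cpos eps e0); rewrite hnorm0 mulr0.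
have resZ eps (t : R) y : 0 < eps -> 0 < t ->
    hnorm (resolvent Jmicro (delta * eps) (t%:C *: y)) =
    t * hnorm (resolvent Jmicro (delta * eps) y).
  move=> e0 t0; have c0 := cpos eps e0.
  rewrite -[t%:C *: y]addr0 resolvent_linear // res0 // addr0.
  by rewrite hnormZr gtr0_norm.
split.
- move=> eps e0; rewrite /opnorm_VH /II /sup_VH.
  rewrite (@sqr_ereal_sup _ _ [set u | dom J u /\ graph_norm J u <= 1]
    [set u | dom J u /\ graph_norm J u = 1]
    (fun u => hnorm (resolvent Jmicro (delta * eps) (V u)))) //.
  + by congr nonneg_sup; apply: eq_imagel => u _; rewrite -res_int.
  + by exists 0; split; rewrite ?graph_norm0.
  + by move=> u [du u1]; split=> //; rewrite u1.
  + move=> u [du u1].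
    apply: (@homogeneous_le _ _ (dom J) (graph_norm J)
      (fun u => hnorm (resolvent Jmicro (delta * eps) (V u)))) => //.
    * by move=> v _; exact: graph_norm_ge0.
    * by move=> t v t0 dv; rewrite graph_normZ // Re_norm_real gtr0_norm.
    * by move=> t v t0 dv; rewrite VZ ?gt_eqF // resZ.
    * by move=> v dv /(graph_norm_eq0 dv) ->; rewrite V0 res0 // hnorm0.
- move=> lambda0 l0.
  (* The total mass of the measure of [V u] is [|V u|^2], bounded on the unit sphere by the squared
     operator norm, which does not depend on [eps]. *)
  have opV u : dom J u -> graph_norm J u <= 1 ->
      ((hnorm (V u))%:E <= opnorm_VH J V)%E.
    by move=> du u1; apply: ereal_sup_ubound; exists u.
  have op0 : (0 <= opnorm_VH J V)%E.
    by apply: le_trans (opV 0 dJ0 _); rewrite ?lee_fin // graph_norm0.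
  have opfin : opnorm_VH J V \is a fin_num by rewrite ge0_fin_numE.
  apply: (@nonneg_sup_weight_split _ _ [set u | dom J u /\ graph_norm J u = 1]
    (fun u => smass pE (V u)) (fine (opnorm_VH J V) ^+ 2)) => //.
    by rewrite sqr_ge0.
  move=> u [du u1]; rewrite /= smassT lee_fin ler_pXn2r ?nnegrE ?fine_ge0 //.
  by rewrite -lee_fin fineK // opV // u1.
move=> F W hF cFE [WS WL Wb WV] IIdual.
have pF : projection_valued_measure F by case: hF.
(* Strong commutation enters here: each [E B] commutes with the spectral measure [F] of [J], hence
   with [J], and so extends to the dual. *)
have EJ B : measurable B -> forall u, dom J u -> dom J (E B u) /\ J (E B u) = E B (J u).
  move=> mB u; apply: (commutant_selfadj hJ hF (T' := E B) (k := 1)).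
  - by move=> c v; exact: (pvmZ pE).
  - by move=> v w; exact: (pvm_rdotC pE).
  - by move=> v; rewrite mul1r; exact: (hnorm_pvm pE).
  - by move=> C mC v; exact: cFE.
have Fmicro B : measurable B -> forall u, dom Jmicro u ->
    dom Jmicro (F B u) /\ Jmicro (F B u) = F B (Jmicro u).
  move=> mB u; apply: (commutant_selfadj hmicro hE (T' := F B) (k := 1)).
  - by move=> c v; exact: (pvmZ pF).
  - by move=> v w; exact: (pvm_rdotC pF).
  - by move=> v; rewrite mul1r; exact: (hnorm_pvm pF).
  - by move=> C mC v; rewrite cFE.
have resL (c : R) : c != 0 -> forall (a : R[i]) u v,
    resolvent Jmicro c (a *: u + v) = a *: resolvent Jmicro c u + resolvent Jmicro c v.
  by move=> c0 a u v; exact: resolvent_linear.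
(* Each [F B] commutes with [Jmicro], hence with its resolvent; the commutant lemma for [J] then
   applies to the resolvent, whose adjoint is [- resolvent Jmicro (- c)]. *)
have resJ (c : R) : c != 0 -> forall u, dom J u ->
    dom J (resolvent Jmicro c u) /\ J (resolvent Jmicro c u) = resolvent Jmicro c (J u).
  move=> c0 u; apply: (commutant_selfadj hJ hF
    (T' := fun z => - resolvent Jmicro (- c) z) (k := `|c|^-1)).
  - move=> a v; have := resL c c0 a v 0; rewrite addr0 => ->.
    suff -> : resolvent Jmicro c 0 = 0 by rewrite addr0.
    apply/eqP; rewrite -hnorm_eq0 eq_le hnorm_ge0 andbT.
    by have := hnorm_resolvent hmicro 0 c0; rewrite hnorm0 mulr0.
  - by move=> v w; rewrite /rdot resolvent_adjoint.
  - by move=> v; exact: hnorm_resolvent.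
  - move=> B mB v; rewrite (@resolvent_commute _ _ _ (F B)) //.
    + by move=> a x y; exact: (pvm_linear pF).
    + exact: Fmicro.
(* From here on [g f] represents [W f], and every dual norm becomes a norm in [H] of an operator
   applied to [g f]. *)
have /choice [g gP] : forall f, exists h, dual_repr J (W f) h.
  by move=> f; apply: dual_repr_exists.
have massE f B : measurable B -> dual_spectral_mass J E (W f) B = smass pE (g f) B.
  move=> mB; rewrite /dual_spectral_mass smassE EFin_expe; congr (_ ^+ 2)%E.
  apply: (dual_repr_norm hJ); apply: (dual_extension_repr hJ (k := 1)) => //.
  - by move=> c u v; exact: (pvm_linear pE).
  - by move=> u; rewrite mul1r; exact: (hnorm_pvm pE).
  - exact: EJ.
have wE f c D : weighted_integral (dual_spectral_mass J E (W f)) c D =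
    weighted_integral (smass pE (g f)) c D.
  by apply: eq_set_function_integral => B mB; exact: massE.
(* Linearity of [W] passes to [g] because representatives are unique. *)
have gZ (t : R) f : g (t%:C *: f) = t%:C *: g f.
  have g0 : g 0 = 0.
    apply: (dual_repr_unique hJ (gP 0)) => v dv; rewrite linear0l.
    by have := WL (-1) 0 0 v dv; rewrite scaler0 addr0 mulN1r addNr.
  apply: (dual_repr_unique hJ (gP _)); rewrite -[X in dual_repr _ _ X]addr0 -g0.
  move=> v dv; rewrite -[X in W X]addr0 (WL _ _ _ v dv).
  exact: (dual_repr_linear _ (gP f) (gP 0)).
have g0 : g 0 = 0.
  by have := gZ 0 0; rewrite scaler0 scale0r.
have normW eps f : 0 < eps ->
    dual_norm J (dual_extension J (resolvent Jmicro (delta * eps)) (W f)) =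
    (hnorm (resolvent Jmicro (delta * eps) (g f)))%:E.
  move=> e0; have c0 := cpos eps e0; apply: (dual_repr_norm hJ).
  apply: (dual_extension_repr hJ (k := `|delta * eps|^-1)) => //.
  - exact: resL.
  - by move=> u; exact: hnorm_resolvent.
  - exact: resJ.
split.
- move=> eps e0; rewrite /opnorm_HVdual /IIdual /sup_HVdual.
  rewrite (@eq_imagel _ _ _ _ (fun f => (hnorm (resolvent Jmicro (delta * eps) (g f)))%:E));
    last by move=> f _; exact: normW.
  rewrite (@sqr_ereal_sup _ _ [set f | hnorm f <= 1] [set f | hnorm f = 1]
    (fun f => hnorm (resolvent Jmicro (delta * eps) (g f)))) //.
  + by congr nonneg_sup; apply: eq_imagel => u _; rewrite wE res_int.
  + by exists 0; rewrite /= hnorm0.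
  + by move=> u /= ->.
  + move=> u u1.
    suff [->|[v [_ v1] uv]] : hnorm (resolvent Jmicro (delta * eps) (g u)) = 0 \/
        exists2 v, setT v /\ hnorm v = 1 &
          hnorm (resolvent Jmicro (delta * eps) (g u)) <=
          hnorm (resolvent Jmicro (delta * eps) (g v)); [by left|by right; exists v|].
    apply: (@homogeneous_le _ _ setT (@hnorm _ H)
      (fun f => hnorm (resolvent Jmicro (delta * eps) (g f)))) => //.
    * by move=> t v t0 _; rewrite hnormZr gtr0_norm.
    * by move=> t v t0 _; rewrite gZ resZ.
    * by move=> v _ /eqP; rewrite hnorm_eq0 => /eqP ->; rewrite g0 res0 // hnorm0.
- move=> lambda0 l0.
  have opW f : hnorm f <= 1 -> ((hnorm (g f))%:E <= opnorm_HVdual J W)%E.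
    by move=> f1; rewrite -(dual_repr_norm hJ (gP f)); apply: ereal_sup_ubound; exists f.
  have op0 : (0 <= opnorm_HVdual J W)%E.
    by apply: le_trans (opW 0 _); rewrite ?lee_fin // hnorm0.
  have opfin : opnorm_HVdual J W \is a fin_num by rewrite ge0_fin_numE.
  have mk f : [set f | hnorm f = 1] f ->
      (smass pE (g f) setT <= (fine (opnorm_HVdual J W) ^+ 2)%:E)%E.
    move=> f1; rewrite smassT lee_fin ler_pXn2r ?nnegrE ?fine_ge0 //.
    by rewrite -lee_fin fineK // opW // f1.
  have [r br rP] := @nonneg_sup_weight_split _ _ [set f | hnorm f = 1]
    (fun f => smass pE (g f)) _ delta lambda0 (sqr_ge0 _) hdelta l0 mk.
  exists r => // eps e0; have := rP eps e0; rewrite /IIdual /sup_HVdual.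
  by do 2 (rewrite -(eq_imagel (fun f _ => wE f (delta * eps) _))).
Qed.
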